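(* Let $d\ge2$, $k\ge1$, and let $Cl^{(d)}_{1\to k}$ be the $1\to k$ universal qudit cloning channel, with isometric extension $U$ and complementary channel $\mathcal{S}^{(d)}_k$. For all $\lambda,\mu\ge0$, the private dynamic capacity formula $$P_{\lambda,\mu}(Cl^{(d)}_{1\to k})=\max_\omega\ I(YX;B)_\omega+\lambda\big[H(B|X)_\omega-H(E|X)_\omega\big]+\mu\big[H(B)_\omega-H(E|X)_\omega\big]$$ is maximized by an ensemble of the form $$\frac1d\sum_{x=1}^d|x\rangle\langle x|^X\otimes\psi_x^{YA'},\qquad \psi_x^{YA'}=\sum_{j=1}^dq_{(j-x)\bmod d}\,|j\rangle\langle j|^Y\otimes|j\rangle\langle j|^{A'},$$ for some $\nu_1,\dots,\nu_{d-1}\ge0$ with $\sum\nu_m\le1$, where $q_0=1-\nu_1-\dots-\nu_{d-1}$ and $q_m=\nu_m$ for $1\le m\le d-1$ (with the $A'$ system sent through $U$).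
   Context: The $1\to k$ universal qudit cloner is the isometry $U:|l\rangle\mapsto\sum_{\vec j\in N(k-1)}\sqrt{(1+j_l)/\binom{k+d-1}{d}}\,|\vec e_l+\vec j\rangle_B\otimes R_{\vec j}$, where $N(m)=\{\vec j\in\mathbb{Z}_{\ge0}^d:\sum j_i=m\}$, $|\vec m\rangle$ is the normalized completely symmetric $k$-qudit state with occupation vector $\vec m$, and $R_{\vec j}$ are orthonormal states of the environment $E$; $Cl^{(d)}_{1\to k}=\mathrm{Tr}_E\circ U$, $\mathcal{S}^{(d)}_k=\mathrm{Tr}_B\circ U$. In the formula, $\omega$ ranges over states $\omega^{XYBE}=\sum_{x,y}p_{X,Y}(x,y)|x\rangle\langle x|^X\otimes|y\rangle\langle y|^Y\otimes U(\psi_{x,y})U^\dagger$ with $\psi_{x,y}$ pure states of $A'$. *)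

(* Defs.v *)
From mathcomp Require Import all_boot all_order all_algebra.
From mathcomp Require Import reals exp.
From mathcomp.real_closed Require Import complex.

Set Implicit Arguments.
Unset Strict Implicit.
Unset Printing Implicit Defensive.

Import Order.TTheory GRing.Theory Num.Theory.
Local Open Scope ring_scope.

(* Occupation vectors N(m) = { j in Z_{>=0}^d : sum_i j_i = m }.
   The normalized completely symmetric state |m> of the k-qudit system B
   is indexed by an element of Occ d k; these states form an orthonormal
   basis of the symmetric subspace, which carries the whole output of B. *)
Definition Occ (d m : nat) :=
  {f : {ffun 'I_d -> 'I_m.+1} | \sum_(i < d) (f i : nat) == m}.

Definition occ (d m : nat) (j : Occ d m) (i : 'I_d) : nat := sval j i.

(* Operators on a finite-dimensional Hilbert space with orthonormal basis T. *)
Definition op (R : realType) (T : finType) := T -> T -> R[i].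

Definition mx_of (R : realType) (T : finType) (A : op R T) : 'M[R[i]]_#|T| :=
  \matrix_(a, b) A (enum_val a) (enum_val b).

Definition xlog2x (R : realType) (x : R) : R :=
  if x == 0 then 0 else x * ln x / ln 2.

Definition vNent (R : realType) (T : finType) (rho : op R T) : R :=
  - \sum_(a < #|T|) xlog2x (complex.Re (spectral_diag (mx_of rho) 0 a)).

(* Partial trace: the total space is indexed by T ~ S x Q via t |-> (f t, g t)
   (coordinate projections); we keep S and trace out Q. *)
Definition marginal (R : realType) (T S Q : finType) (f : T -> S) (g : T -> Q)
  (rho : op R T) : op R S :=
  fun s s' => \sum_(t : T) \sum_(t' : T)
     (if (f t == s) && (f t' == s') && (g t == g t') then rho t t' else 0).

(* The isometry U : A' (dim d) -> B (x) E of the 1 -> k universal cloner: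
   U|l> = sum_{j in N(k-1)} sqrt((1+j_l)/C(k+d-1,d)) |e_l + j>_B (x) R_j. *)
Definition Ucl (R : realType) (d k : nat) (be : Occ d k * Occ d k.-1) (l : 'I_d)
  : R[i] :=
  if [forall i : 'I_d, occ be.1 i == (occ be.2 i + (i == l))%N]
  then (Num.sqrt ((1 + occ be.2 l)%:R / ('C(k + d - 1, d))%:R) : R)%:C%C
  else 0.

Definition Uapp (R : realType) (d k : nat) (psi : 'I_d -> R[i])
  (be : Occ d k * Occ d k.-1) : R[i] :=
  \sum_(l < d) @Ucl R d k be l * psi l.

Definition Sys (d k nX nY : nat) :=
  ('I_nX * 'I_nY * (Occ d k * Occ d k.-1))%type.

(* omega^{XYBE} = sum_{x,y} p(x,y) |x><x| (x) |y><y| (x) U psi_{x,y} U^dagger,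
   psi_{x,y} = |psi x y><psi x y| pure. *)
Definition omega (R : realType) (d k nX nY : nat) (p : 'I_nX -> 'I_nY -> R)
  (psi : 'I_nX -> 'I_nY -> 'I_d -> R[i]) : op R (Sys d k nX nY) :=
  fun t t' =>
    let: (x, y, be) := t in let: (x', y', be') := t' in
    if (x == x') && (y == y')
    then (p x y)%:C%C * @Uapp R d k (psi x y) be * (@Uapp R d k (psi x y) be')^*
    else 0.

Definition ensemble_ok (R : realType) (d nX nY : nat) (p : 'I_nX -> 'I_nY -> R)
  (psi : 'I_nX -> 'I_nY -> 'I_d -> R[i]) : Prop :=
  [/\ forall x y, 0 <= p x y,
      \sum_(x < nX) \sum_(y < nY) p x y = 1 &
      forall x y, \sum_(l < d) psi x y l * (psi x y l)^* = 1].

Section Objective.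
Variables (R : realType) (d k nX nY : nat) (p : 'I_nX -> 'I_nY -> R)
  (psi : 'I_nX -> 'I_nY -> 'I_d -> R[i]).
Let w := @omega R d k nX nY p psi.
Let T := Sys d k nX nY.
Let X (t : T) := t.1.1.
Let Y (t : T) := t.1.2.
Let B (t : T) := t.2.1.
Let E (t : T) := t.2.2.

Definition H_YX : R := vNent (marginal (fun t => (Y t, X t)) (fun t => t.2) w).
Definition H_B : R := vNent (marginal B (fun t => (X t, Y t, E t)) w).
Definition H_YXB : R := vNent (marginal (fun t => (Y t, X t, B t)) E w).
Definition H_X : R := vNent (marginal X (fun t => (Y t, B t, E t)) w).
Definition H_XB : R := vNent (marginal (fun t => (X t, B t)) (fun t => (Y t, E t)) w).
Definition H_XE : R := vNent (marginal (fun t => (X t, E t)) (fun t => (Y t, B t)) w).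

Definition I_YX_B : R := H_YX + H_B - H_YXB.
Definition H_B_given_X : R := H_XB - H_X.
Definition H_E_given_X : R := H_XE - H_X.

Definition objective (lam mu : R) : R :=
  I_YX_B + lam * (H_B_given_X - H_E_given_X) + mu * (H_B - H_E_given_X).
End Objective.

Definition qnu (R : realType) (d : nat) (nu : nat -> R) (m : nat) : R :=
  if m == 0%N then 1 - \sum_(1 <= m' < d) nu m' else nu m.

Definition p_opt (R : realType) (d : nat) (nu : nat -> R) (x y : 'I_d) : R :=
  qnu d nu ((y + d - x) %% d) / d%:R.

Definition psi_opt (R : realType) (d : nat) (x y l : 'I_d) : R[i] :=
  (l == y)%:R.

(* Main.v *)
(* On the symmetric subspace the cloner output of a state s is proportional to
   the second quantisation of s, so its spectrum consists of the numbers
   (sum_l r_l m_l) / binom(k+d-1,d), where r is the spectrum of s and m ranges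
   over the occupation vectors.  To see this, conjugate by the norms of the
   monomials: the second quantisation becomes the derivation
   sum s_(l,l') X_l' d/dX_l of homogeneous polynomials, whose eigenvectors are
   the monomials in the linear forms diagonalising s.  The environment state is
   the analogue with m_l replaced by 1 + j_l.
   Hence the objective is (1 + mu) H(B) - c + sum_x p_x F(q_x), with c a
   constant and q_x the spectrum of the normalised input given x.  The first
   term is largest when B is maximally mixed, and F, being continuous, attains
   its maximum on the simplex at some q.  Since F is invariant under
   permutations, the cyclic shifts of q, with uniform p_x, attain both maxima
   simultaneously. *)
Require Import Defs.
From mathcomp Require Import all_boot all_order all_algebra.
From mathcomp Require mpoly.

Set Implicit Arguments.
Unset Strict Implicit.
Unset Printing Implicit Defensive.

Import Order.TTheory GRing.Theory Num.Theory.
Local Open Scope ring_scope.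

(** * Occupation vectors as functions with prescribed sum *)

Section OccBasics.
Variables d n : nat.
Implicit Types b : Occ d n.

Lemma occP b b' : reflect (forall i, occ b i = occ b' i) (b == b').
Proof.
apply: (iffP eqP) => [-> //|h]; apply/val_inj/ffunP => i.
by apply/val_inj; apply: h.
Qed.

Lemma sum_occ b : (\sum_i occ b i)%N = n.
Proof. exact: (eqP (valP b)). Qed.

(** Each value of [f] is at most the total [n], so the bounded entries of [Occ] lose nothing and
    vectors can be built from plain functions. *)
Lemma occ_surj (f : 'I_d -> nat) :
  (\sum_i f i)%N = n -> exists b : Occ d n, forall i, occ b i = f i.
Proof.
move=> fn; have fle i : (f i < n.+1)%N.
  by rewrite ltnS -fn (bigD1 i) //= leq_addr.
have hf : \sum_(i < d) ([ffun i => Ordinal (fle i)] i : nat) == n.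
  by apply/eqP; rewrite -[RHS]fn; apply: eq_bigr => i _; rewrite ffunE.
exists (exist (fun f : {ffun 'I_d -> 'I_n.+1} => \sum_(i < d) (f i : nat) == n)
  _ hf) => i.
by rewrite /occ /= ffunE.
Qed.

End OccBasics.

(** * Symmetric powers of matrices and derivations of homogeneous polynomials *)

Module SymPower.
Import mpoly.

Section Occupation.
Variables d n : nat.
Implicit Types b : Occ d n.

Definition mon b : 'X_{1..d} := [multinom occ b i | i < d].

Lemma monE b i : mon b i = occ b i.
Proof. by rewrite mnmE. Qed.

Lemma mon_inj : injective mon.
Proof.
by move=> b b' /mnmP h; apply/eqP/occP => i; rewrite -!monE h.
Qed.

Lemma mdeg_mon b : mdeg (mon b) = n.
Proof.
by rewrite mdegE -[RHS](sum_occ b); apply: eq_bigr => i _; rewrite monE.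
Qed.

Lemma mon_surj m : mdeg m = n -> exists b, mon b = m.
Proof.
rewrite mdegE => /occ_surj [b hb]; exists b.
by apply/mnmP => i; rewrite monE hb.
Qed.

End Occupation.

Section Sym.
Variables (K : comNzRingType) (d : nat).
Implicit Types (V W S : 'M[K]_d) (r : 'I_d -> K).

Lemma homog_sum n (p : {mpoly K[d]}) : p \is n.-homog ->
  p = \sum_(b : Occ d n) p@_(mon b) *: 'X_[mon b].
Proof.
move=> hp; apply/mpolyP => m; rewrite raddf_sum /=.
have [mn|mn] := eqVneq (mdeg m) n; last first.
  rewrite (dhomog_nemf_coeff hp) // big1 // => b _.
  rewrite mcoeffZ mcoeffX; case: eqP => [E|_]; last by rewrite mulr0.
  by rewrite -E mdeg_mon eqxx in mn.
have [b <-] := mon_surj mn.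
rewrite (bigD1 b) //= mcoeffZ mcoeffX eqxx mulr1 big1 ?addr0 // => b' nb.
by rewrite mcoeffZ mcoeffX (inj_eq (@mon_inj _ _)) (negbTE nb) mulr0.
Qed.

Definition lin V (i : 'I_d) : {mpoly K[d]} := \sum_l V i l *: 'X_l.

Definition form V n (a : Occ d n) : {mpoly K[d]} :=
  \prod_i lin V i ^+ occ a i.

(* The matrix of the [n]-th symmetric power of [V] in the monomial basis. *)
Definition symm V n (a b : Occ d n) : K := (form V a)@_(mon b).

Lemma lin_homog V i : lin V i \is 1.-homog.
Proof.
apply: rpred_sum => l _; apply: rpredZ; by rewrite dhomogX; apply/eqP/mdeg1.
Qed.

Lemma form_homog V n (a : Occ d n) : form V a \is n.-homog.
Proof.
suff: form V a \is (\sum_i occ a i)%N.-homog by rewrite sum_occ.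
rewrite /form; elim/big_rec2: _ => [|i x y _ h]; first exact: dhomog1.
apply: dhomogM => //.
by have := dhomogMn (occ a i) (lin_homog V i); rewrite mul1n.
Qed.

(** Substituting the linear forms of [W] for the variables is an algebra morphism [phi]. It sends
    [form V a] to [form (V *m W) a] and the monomial of [b] to [form W b], so expanding [form V a]
    in monomials gives the matrix product. *)
Lemma symm_mul V W n (a c : Occ d n) :
  symm (V *m W) a c = \sum_b symm V a b * symm W b c.
Proof.
pose phi := comp_mpoly [tuple lin W i | i < d].
have philin i : phi (lin V i) = lin (V *m W) i.
  rewrite /phi /lin raddf_sum /=.
  under eq_bigr => l _ do rewrite comp_mpolyZ comp_mpolyXU -tnth_nth
    tnth_mktuple /lin scaler_sumr.
  rewrite exchange_big /=; apply: eq_bigr => j _; rewrite mxE scaler_suml.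
  by apply: eq_bigr => l _; rewrite scalerA.
have phiform : phi (form V a) = form (V *m W) a.
  rewrite /phi /form rmorph_prod; apply: eq_bigr => i _.
  by rewrite rmorphXn /= -/phi philin.
rewrite /symm -phiform {1}(homog_sum (form_homog V a)) /phi.
rewrite (raddf_sum (comp_mpoly _)).
rewrite raddf_sum; apply: eq_bigr => b _ /=.
rewrite comp_mpolyZ mcoeffZ comp_mpolyX.
congr (_ * _@_ _); apply: eq_bigr => i _.
by rewrite tnth_mktuple monE.
Qed.

Lemma symm1 n (a b : Occ d n) : symm 1%:M a b = (a == b)%:R.
Proof.
rewrite /symm (_ : form _ a = 'X_[mon a]) ?mcoeffX ?(inj_eq (@mon_inj _ _)) //.
rewrite mpolyXE_id; apply: eq_bigr => i _; rewrite monE; congr (_ ^+ _).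
rewrite /lin (bigD1 i) //= mxE eqxx scale1r big1 ?addr0 // => j ij.
by rewrite mxE eq_sym (negbTE ij) scale0r.
Qed.

(* [dpoly S] is the derivation sending the linear form [v] to [v S]. *)
Definition dpoly S (f : {mpoly K[d]}) : {mpoly K[d]} :=
  \sum_l \sum_l' S l l' *: ('X_l' * f^`M(l)).

Lemma dpolyM S f g : dpoly S (f * g) = dpoly S f * g + f * dpoly S g.
Proof.
rewrite /dpoly mulr_suml mulr_sumr -big_split; apply: eq_bigr => l _ /=.
rewrite mulr_suml mulr_sumr -big_split; apply: eq_bigr => l' _ /=.
rewrite mderivM mulrDr scalerDr -scalerAl -scalerAr; congr (_ *: _ + _ *: _).
  by rewrite mulrA.
by rewrite mulrCA.
Qed.

Lemma dpoly1 S : dpoly S 1 = 0.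
Proof.
rewrite /dpoly big1 // => l _; rewrite big1 // => l' _.
by rewrite -mpolyC1 mderivC mulr0 scaler0.
Qed.

Lemma dpoly_lin S V r : V *m S = diag_mx (\row_i r i) *m V ->
  forall i, dpoly S (lin V i) = r i *: lin V i.
Proof.
move=> VS i; rewrite /dpoly exchange_big /lin scaler_sumr /=.
apply: eq_bigr => l' _.
have dl l : (\sum_l0 V i l0 *: 'X_l0)^`M(l) = (V i l)%:MP_[d].
  rewrite raddf_sum (bigD1 l) //= big1 => [|j jl]; last first.
    by rewrite mderivZ mderivX mnm1E (negbTE jl) scale0r scaler0.
  rewrite addr0 mderivZ mderivX mnm1E eqxx scale1r.
  have -> : (U_(l) - U_(l) = 0)%MM.
    by apply/mnmP => k; rewrite mnmBE subnn mnm0E.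
  by rewrite mpolyX0 -mul_mpolyC mulr1.
under eq_bigr => l _ do rewrite dl mulrC mul_mpolyC scalerA.
rewrite -scaler_suml scalerA; congr (_ *: _).
move/matrixP/(_ i l'): VS; rewrite mul_diag_mx !mxE => <-.
by apply: eq_bigr => l _; rewrite mulrC.
Qed.

(** The hypothesis makes row [i] of [V] a left eigenvector of [S], so [lin V i] is an eigenvector of
    [dpoly S]. By the Leibniz rule the eigenvalues of a derivation add up along a product. *)
Lemma dpoly_form S V r n (a : Occ d n) :
  V *m S = diag_mx (\row_i r i) *m V ->
  dpoly S (form V a) = (\sum_i r i * (occ a i)%:R) *: form V a.
Proof.
move=> /dpoly_lin VS; rewrite /form.
elim/big_rec2: _ => [|i x y _ h]; first by rewrite dpoly1 scale0r.
rewrite dpolyM h scalerDl -scalerAr; congr (_ + _).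
rewrite scalerAl; congr (_ * _).
elim: (occ a i) => [|m IH]; first by rewrite expr0 dpoly1 mulr0 scale0r.
rewrite exprS dpolyM VS IH -scalerAl -scalerAr -scalerDl; congr (_ *: _).
by rewrite mulrSr mulrDr mulr1 addrC.
Qed.

(** Matrix of [dpoly S] in the monomial basis. The test says b' = b - e_l + e_l', written without
    subtraction because the entries are natural numbers. *)
Definition dsym S n (b b' : Occ d n) : K :=
  \sum_l \sum_l' S l l' * (occ b l)%:R *
    [forall i, occ b i + (i == l') == occ b' i + (i == l)]%N%:R.

Lemma dpoly_mon S n (b b' : Occ d n) :
  (dpoly S 'X_[mon b])@_(mon b') = dsym S b b'.
Proof.
rewrite /dpoly raddf_sum; apply: eq_bigr => l _ /=.
rewrite raddf_sum; apply: eq_bigr => l' _ /=.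
rewrite mcoeffZ mderivX -scalerAr mcoeffZ -mpolyXD mcoeffX monE mulrA.
(* If b_l = 0 the truncated exponent b - e_l is meaningless, but its coefficient b_l kills the
   term. *)
have [->|bl] := posnP (occ b l); first by rewrite mulr0 !mul0r.
congr (_ * (_ : bool)%:R); apply/eqP/forallP => [/mnmP h i|h].
  have := h i; rewrite mnmDE mnmBE !mnm1E !monE => <-.
  rewrite (eq_sym l') (eq_sym l).
  have : ((i == l) <= occ b i)%N by case: eqP => [->|].
  by move=> hb; rewrite addnAC -addnA subnKC // addnC.
apply/mnmP => i; rewrite mnmDE mnmBE !mnm1E !monE.
have /eqP := h i; rewrite (eq_sym i) (eq_sym i l) => hi.
have hb : ((l == i) <= occ b i)%N by case: eqP => [<-|].
by rewrite addnBA // addnC hi addnK.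
Qed.

Lemma dpoly_sum S (I : finType) (f : I -> {mpoly K[d]}) :
  dpoly S (\sum_i f i) = \sum_i dpoly S (f i).
Proof.
rewrite /dpoly [RHS]exchange_big; apply: eq_bigr => l _ /=.
rewrite [RHS]exchange_big; apply: eq_bigr => l' _ /=.
by rewrite raddf_sum mulr_sumr scaler_sumr.
Qed.

Lemma dpolyZ S c f : dpoly S (c *: f) = c *: dpoly S f.
Proof.
rewrite /dpoly scaler_sumr; apply: eq_bigr => l _ /=.
rewrite scaler_sumr; apply: eq_bigr => l' _ /=.
by rewrite mderivZ -scalerAr !scalerA mulrC.
Qed.

(** This is [dpoly_form] read coefficientwise: the rows of the symmetric power of [V] are left
    eigenvectors of [dsym S]. *)
Lemma symm_dsym S V r n (a b' : Occ d n) :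
  V *m S = diag_mx (\row_i r i) *m V ->
  \sum_b symm V a b * dsym S b b' =
    (\sum_i r i * (occ a i)%:R) * symm V a b'.
Proof.
move=> VS; have := dpoly_form a VS.
rewrite {1}(homog_sum (form_homog V a)) dpoly_sum.
move/(congr1 (mcoeff (mon b'))); rewrite raddf_sum mcoeffZ {2}/symm => <-.
by apply: eq_bigr => b _ /=; rewrite dpolyZ mcoeffZ dpoly_mon.
Qed.

End Sym.
End SymPower.

From mathcomp Require Import ring perm boolp classical_sets filter.
From mathcomp Require Import reals exp topology normedtype derive.
From mathcomp.real_closed Require Import complex.
Import numFieldNormedType.Exports.

(** * Spectra of Hermitian operators and their entropy *)

Section Spectrum.
Variable R : realType.
Local Notation C := R[i].

Lemma conj_real (c : R) : (c%:C%C : C)^* = c%:C%C.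
Proof. exact: conjc_real. Qed.

(* Intertwining two diagonal matrices means matching eigenvalues wherever the
   intertwiner is nonzero, so functions of them are intertwined as well. *)
Lemma sum_intertwined (K : idomainType) n (N M : 'M[K]_n) (x y : 'rV[K]_n)
    (f : K -> K) :
  N *m M = 1%:M -> diag_mx y *m N = N *m diag_mx x ->
  \sum_i f (y 0 i) = \sum_i f (x 0 i).
Proof.
move=> NM yN.
have fyN : diag_mx (map_mx f y) *m N = N *m diag_mx (map_mx f x).
  apply/matrixP => i j; move/matrixP/(_ i j): yN.
  rewrite !mul_diag_mx !mul_mx_diag !mxE.
  rewrite [N i j * x 0 j]mulrC => /eqP.
  rewrite -subr_eq0 -mulrBl mulf_eq0 subr_eq0 => /orP [] /eqP ->.
    by rewrite mulrC.
  by rewrite mulr0 mul0r.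
have trf (z : 'rV[K]_n) : \sum_i f (z 0 i) = \tr (diag_mx (map_mx f z)).
  by rewrite mxtrace_diag; apply: eq_bigr => i _; rewrite mxE.
rewrite !trf -[LHS]/(\tr _) -[X in \tr X = _]mulmx1 -NM mulmxA fyN -mulmxA.
by rewrite mxtrace_mulC -mulmxA (mulmx1C NM) mulmx1.
Qed.

Lemma sum_enum_val (V : nmodType) (T : finType) (F : T -> V) :
  \sum_(a < #|T|) F (enum_val a) = \sum_t F t.
Proof.
by rewrite [RHS](reindex (@enum_val T T)) //; apply/onW_bij/enum_val_bij.
Qed.

Lemma mx_of_mul (T : finType) (A B : op R T) :
  mx_of A *m mx_of B = mx_of (fun s t => \sum_u A s u * B u t).
Proof.
apply/matrixP => a b; rewrite !mxE -(sum_enum_val (fun u => A _ u * B u _)).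
by apply: eq_bigr => c _; rewrite !mxE.
Qed.

(** The diagonalising [V] is only asked to be invertible, with inverse [W], rather than unitary. A
    rescaled symmetric power then qualifies with no check of orthonormality. The eigenvalues are
    indexed by the basis [T] itself. *)
Definition has_spectrum (T : finType) (A : op R T) (s : T -> R) : Prop :=
  (forall t t', A t t' = (A t' t)^*) /\
  exists V W : op R T,
    (forall t t', \sum_u V t u * W u t' = (t == t')%:R) /\
    (forall t t', \sum_u V t u * A u t' = (s t)%:C%C * V t t').

Lemma hermitian_normal n (A : 'M[C]_n) :
  (forall a b, A a b = (A b a)^*) -> A \is normalmx.
Proof.
move=> hA; apply/normalmxP; congr (_ *m _); last apply: esym.
  by apply/matrixP => a b; rewrite !mxE hA.
by apply/matrixP => a b; rewrite !mxE hA.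
Qed.

(** With [P] the unitary of the spectral theorem, [V] times the inverse of [P] intertwines the two
    diagonal forms of [A], so [sum_intertwined] identifies the sums of [xlog2x] over the two lists
    of eigenvalues. *)
Lemma vNent_spectrum (T : finType) (A : op R T) s :
  has_spectrum A s -> vNent A = - \sum_t xlog2x (s t).
Proof.
move=> [hA [V [W [VW VA]]]]; rewrite /vNent; congr (- _).
set M := mx_of A.
have /orthomx_spectralP : M \is normalmx.
  by apply: hermitian_normal => a b; rewrite !mxE hA.
set P := spectralmx M; set x := spectral_diag M => MP.
have Pu : P \in unitmx by apply: spectral_unit.
have VWm : mx_of V *m mx_of W = 1%:M.
  rewrite mx_of_mul; apply/matrixP => a b; rewrite !mxE VW.
  by rewrite (inj_eq enum_val_inj).
pose y : 'rV[C]_#|T| := \row_a (s (enum_val a))%:C%C.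
have VAm : mx_of V *m M = diag_mx y *m mx_of V.
  rewrite mx_of_mul; apply/matrixP => a b; rewrite mul_diag_mx !mxE VA.
  by [].
pose f (z : C) := (xlog2x (complex.Re z))%:C%C.
have /(@sum_intertwined _ _ (mx_of V *m invmx P) (P *m mx_of W) x y f) h :
    (mx_of V *m invmx P) *m (P *m mx_of W) = 1%:M.
  by rewrite mulmxA mulmxKV.
have /h : diag_mx y *m (mx_of V *m invmx P) = mx_of V *m invmx P *m diag_mx x.
  by rewrite mulmxA -VAm {1}MP !mulmxA mulmxK.
rewrite /f -!rmorph_sum /= => /complexI; under eq_bigr do rewrite mxE /=.
by rewrite (sum_enum_val (fun t => xlog2x (s t))) => ->.
Qed.

Lemma has_spectrum_eq (T : finType) (A B : op R T) s :
  (forall t t', A t t' = B t t') -> has_spectrum A s -> has_spectrum B s.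
Proof.
move=> AB [hA [V [W [VW VA]]]]; split; first by move=> t t'; rewrite -!AB.
exists V, W; split=> // t t'; rewrite -VA.
by apply: eq_bigr => u _; rewrite AB.
Qed.

Lemma has_spectrum_scale (T : finType) (A : op R T) s (c : R) :
  has_spectrum A s ->
  has_spectrum (fun t t' => c%:C%C * A t t') (fun t => c * s t).
Proof.
move=> [hA [V [W [VW VA]]]]; split.
  by move=> t t'; rewrite rmorphM /= -hA; congr (_ * _); rewrite conj_real.
exists V, W; split=> // t t'; rewrite rmorphM /= -mulrA -VA mulr_sumr.
by apply: eq_bigr => u _; rewrite mulrCA.
Qed.

Lemma has_spectrum_diag (T : finType) (s : T -> R) :
  has_spectrum (fun t t' => if t == t' then (s t)%:C%C else 0) s.
Proof.
split=> [t t'|].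
  rewrite eq_sym; case: eqP => [->|_]; last by rewrite rmorph0.
  by rewrite conj_real.
exists (fun t t' => (t == t')%:R), (fun t t' => (t == t')%:R); split=> t t'.
  rewrite (bigD1 t) //= eqxx mul1r big1 ?addr0 // => u ut.
  by rewrite eq_sym (negbTE ut) mul0r.
rewrite (bigD1 t) //= eqxx mul1r big1 ?addr0 => [|u ut]; last first.
  by rewrite eq_sym (negbTE ut) mul0r.
by case: eqP => _; rewrite ?mulr1 ?mulr0.
Qed.

(** From V A = D V follows A W = W D; transposing, the transpose of [W] diagonalises the transpose
    of [A]. The environment state involves the transposed input. *)
Lemma has_spectrum_tr (T : finType) (A : op R T) s :
  has_spectrum A s -> has_spectrum (fun t t' => A t' t) s.
Proof.
move=> [hA [V [W [VW VA]]]]; split; first by move=> t t'.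
have WV : mx_of W *m mx_of V = 1%:M.
  apply: mulmx1C; rewrite mx_of_mul; apply/matrixP => a b; rewrite !mxE VW.
  by rewrite (inj_eq enum_val_inj).
pose D : op R T := fun t t' => if t == t' then (s t)%:C%C else 0.
have DV : mx_of V *m mx_of A = mx_of D *m mx_of V.
  rewrite !mx_of_mul; apply/matrixP => a b; rewrite !mxE VA.
  rewrite (bigD1 (enum_val a)) //= /D eqxx big1 ?addr0 // => u ut.
  by rewrite eq_sym (negbTE ut) mul0r.
have AW : mx_of A *m mx_of W = mx_of W *m mx_of D.
  rewrite -[LHS]mul1mx -WV -mulmxA (mulmxA (mx_of V)) DV -!mulmxA.
  congr (_ *m _); rewrite -[RHS]mulmx1; congr (_ *m _); apply: mulmx1C.
  exact: WV.
exists (fun t t' => W t' t), (fun t t' => V t' t); split=> t t'.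
  rewrite eq_sym -VW.
  by apply: eq_bigr => u _; rewrite mulrC.
move/matrixP/(_ (enum_rank t') (enum_rank t)): AW.
rewrite !mx_of_mul !mxE !enum_rankK [X in _ = X](bigD1 t) //= /D eqxx.
rewrite [X in _ = _ + X]big1 ?addr0 => [|u ut]; last first.
  by rewrite (negbTE ut) mulr0.
by rewrite mulrC => <-; apply: eq_bigr => u _; rewrite mulrC.
Qed.

(** States with a classical register are direct sums over its values, and direct sums of the [V] and
    [W] of the blocks diagonalise them. *)
Lemma has_spectrum_block (Z T : finType) (A : Z -> op R T) (s : Z -> T -> R) :
  (forall z, has_spectrum (A z) (s z)) ->
  has_spectrum (fun u v : Z * T => if u.1 == v.1 then A u.1 u.2 v.2 else 0)
    (fun u => s u.1 u.2).
Proof.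
move=> hA; split=> [[z t] [z' t'] /=|].
  rewrite eq_sym; case: eqP => [->|_]; last by rewrite rmorph0.
  exact: (hA z).1.
have /choice [V hV] : forall z, exists V : op R T, exists W : op R T,
    (forall t t', \sum_u V t u * W u t' = (t == t')%:R) /\
    (forall t t', \sum_u V t u * A z u t' = (s z t)%:C%C * V t t').
  by move=> z; have [_ h] := hA z; exact: h.
have /choice [W hW] := hV.
exists (fun u v : Z * T => if u.1 == v.1 then V u.1 u.2 v.2 else 0).
exists (fun u v : Z * T => if u.1 == v.1 then W u.1 u.2 v.2 else 0).
have blk z t z' t' (F G : Z -> op R T) :
    \sum_(w : Z * T) (if z == w.1 then F z t w.2 else 0) *
      (if w.1 == z' then G w.1 w.2 t' else 0)
    = if z == z' then \sum_u F z t u * G z u t' else 0.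
  rewrite -(pair_bigA _ (fun x u => (if z == x then F z t u else 0) *
      (if x == z' then G x u t' else 0))) /=.
  rewrite (bigD1 z) //= eqxx [X in _ + X]big1 ?addr0 => [|x xz]; last first.
    by apply: big1 => u _; rewrite eq_sym (negbTE xz) mul0r.
  case: eqP => [->//|_]; by apply: big1 => u _; rewrite mulr0.
split=> [[z t] [z' t'] /=|[z t] [z' t'] /=].
  rewrite blk xpair_eqE; case: eqP => //= _; exact: (hW z).1.
rewrite blk; case: eqP => _; last by rewrite mulr0.
exact: (hW z).2.
Qed.

(** In a spectral basis each eigenvalue is a diagonal entry, namely the sum over [y] of [p y] times
    a squared overlap with [psi y]; this shows that it is nonnegative. The eigenvalues sum to the
    trace. *)
Lemma mixture_spectrum d (Y : finType) (p : Y -> R) (psi : Y -> 'I_d -> C) :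
  (forall y, 0 <= p y) ->
  (forall y, \sum_l psi y l * (psi y l)^* = 1) ->
  exists r : 'I_d -> R,
    [/\ forall l, 0 <= r l, \sum_l r l = \sum_y p y &
        has_spectrum (fun l l' => \sum_y (p y)%:C%C * psi y l * (psi y l')^*) r].
Proof.
move=> p0 psi1.
pose A : op R 'I_d := fun l l' => \sum_y (p y)%:C%C * psi y l * (psi y l')^*.
rewrite -/A.
have hA l l' : A l l' = (A l' l)^*.
  rewrite /A rmorph_sum; apply: eq_bigr => y _.
  by rewrite /= !rmorphM /= conjCK conj_real mulrAC.
pose M : 'M[C]_d := \matrix_(l, l') A l l'.
have /orthomx_spectralP : M \is normalmx.
  by apply: hermitian_normal => a b; rewrite !mxE.
set P := spectralmx M; set x := spectral_diag M => MP.
have Pu : P \is unitarymx by apply: spectral_unitarymx.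
have PA : P *m M = diag_mx x *m P.
  by rewrite {1}MP !mulmxA mulmxV ?mul1mx // unitarymx_unit.
have PP : P *m (map_mx Num.conj P^T) = 1%:M by apply/unitarymxP.
have xE l : x 0 l = \sum_y (p y)%:C%C * (\sum_i P l i * psi y i) *
    (\sum_i P l i * psi y i)^*.
  have : (P *m M *m (map_mx Num.conj P^T)) l l = x 0 l.
    by rewrite PA -mulmxA PP mulmx1 mxE eqxx.
  move=> <-; rewrite mxE.
  transitivity (\sum_j \sum_i \sum_y
      (p y)%:C%C * (P l i * psi y i) * (P l j * psi y j)^*).
    apply: eq_bigr => j _; rewrite !mxE mulr_suml; apply: eq_bigr => i _.
    rewrite !mxE /A mulr_sumr mulr_suml; apply: eq_bigr => y _.
    rewrite rmorphM /= !mulrA mulrAC; congr (_ * _).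
    by rewrite [P l i * _]mulrC mulrAC.
  under eq_bigr => j _ do rewrite exchange_big.
  rewrite exchange_big /=; apply: eq_bigr => y _.
  rewrite rmorph_sum /= mulr_sumr; apply: eq_bigr => j _.
  by rewrite mulr_sumr mulr_suml.
have x0 l : 0 <= x 0 l.
  rewrite xE; apply: sumr_ge0 => y _; rewrite -mulrA mulr_ge0 ?mul_conjC_ge0 //.
  by rewrite ler0c.
have xr l : (complex.Re (x 0 l))%:C%C = x 0 l.
  by apply: RRe_real; apply: ger0_real.
exists (fun l => complex.Re (x 0 l)); split.
- by move=> l; rewrite -ler0c xr.
- apply: complexI; rewrite !rmorph_sum /=; under eq_bigr do rewrite xr.
  transitivity (\tr M).
    by rewrite MP mxtrace_mulC mulmxA mulmxV ?mul1mx ?mxtrace_diag ?unitarymx_unit.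
  transitivity (\sum_l A l l); first by apply: eq_bigr => l _; rewrite mxE.
  rewrite /A.
  rewrite exchange_big; apply: eq_bigr => y _ /=.
  under eq_bigr do rewrite -mulrA.
  by rewrite -mulr_sumr psi1 mulr1.
- split=> //; exists (fun l i => P l i), (fun l i => (P i l)^*).
  split=> t t'.
    move/matrixP/(_ t t'): PP; rewrite !mxE => <-.
    by apply: eq_bigr => i _; rewrite !mxE.
  move/matrixP/(_ t t'): PA; rewrite mul_diag_mx !mxE xr => <-.
  by apply: eq_bigr => i _; rewrite !mxE.
Qed.

(** A rank-one projector is idempotent, so its eigenvalues are 0 or 1; being nonnegative with trace
    1, exactly one of them is 1. *)
Lemma pure_spectrum d (psi : 'I_d -> C) :
  \sum_l psi l * (psi l)^* = 1 ->
  exists a : 'I_d,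
    has_spectrum (fun l l' => psi l * (psi l')^*) (fun l => (l == a)%:R).
Proof.
move=> psi1.
have [] := @mixture_spectrum d 'I_1 (fun=> 1) (fun=> psi); [by []|by []|].
move=> r [r0 rs hr].
have {}hr : has_spectrum (fun l l' => psi l * (psi l')^*) r.
  by apply: has_spectrum_eq hr => l l'; rewrite big_ord1 mul1r.
have [_ [V [W [VW VA]]]] := hr.
have sq v t' : \sum_u (psi v * (psi u)^*) * (psi u * (psi t')^*) =
    psi v * (psi t')^*.
  rewrite -[RHS]mulr1 -psi1 mulr_sumr; apply: eq_bigr => u _.
  by rewrite mulrACA [RHS]mulrACA [X in _ = _ * X]mulrC.
have idem t : r t * r t = r t.
  have : \sum_t' (r t)%:C%C * (r t)%:C%C * V t t' * W t' t =
      \sum_t' (r t)%:C%C * V t t' * W t' t.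
    apply: eq_bigr => t' _; congr (_ * _).
    rewrite -mulrA -{1}VA mulr_sumr.
    under eq_bigr => u _ do rewrite mulrA -VA mulr_suml.
    rewrite exchange_big -VA /=; apply: eq_bigr => v _.
    by rewrite -sq mulr_sumr; apply: eq_bigr => u _; rewrite [RHS]mulrA.
  under eq_bigr do rewrite -mulrA.
  under [X in _ = X -> _]eq_bigr do rewrite -mulrA.
  rewrite -!mulr_sumr VW eqxx !mulr1 -rmorphM /=; exact: complexI.
have r01 t : r t = 0 \/ r t = 1.
  move/eqP: (idem t); rewrite -subr_eq0 -{3}[r t]mulr1 -mulrBr mulf_eq0.
  by case/orP => /eqP; [left|right; apply/eqP; rewrite -subr_eq0; apply/eqP].
have rs1 : \sum_l r l = 1 by rewrite rs big_ord1.
case: (pickP (fun a => r a == 1)) => [a /eqP ra|h]; last first.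
  move: rs1; rewrite big1 => [|l _]; first by move/eqP; rewrite eq_sym oner_eq0.
  by case: (r01 l) => // /eqP; rewrite h.
exists a; have -> : (fun l => (l == a)%:R) = r.
  apply/funext => l; case: eqP => [->//|/eqP la]; apply/esym/eqP.
  rewrite eq_le r0 andbT; move: rs1.
  rewrite (bigD1 a) //= (bigD1 l) //= ra => /eqP.
  rewrite -subr_eq0 addrAC subrr add0r addr_eq0 => /eqP ->.
  by rewrite oppr_le0 sumr_ge0.
exact: hr.
Qed.

End Spectrum.

(** * Second quantisation and its spectrum *)

Section Channels.
Variables (R : realType) (d : nat).
Local Notation C := R[i].
Import SymPower.

Lemma trace_spectrum (T : finType) (A : op R T) s :
  has_spectrum A s -> \sum_t A t t = (\sum_t s t)%:C%C.
Proof.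
move=> [hA [V [W [VW VA]]]].
have VWm : mx_of V *m mx_of W = 1%:M.
  rewrite mx_of_mul; apply/matrixP => a b; rewrite !mxE VW.
  by rewrite (inj_eq enum_val_inj).
pose y : 'rV[C]_#|T| := \row_a (s (enum_val a))%:C%C.
have VAm : mx_of V *m mx_of A = diag_mx y *m mx_of V.
  by rewrite mx_of_mul; apply/matrixP => a b; rewrite mul_diag_mx !mxE VA.
transitivity (\tr (mx_of A)).
  rewrite -(sum_enum_val (fun t => A t t)).
  by apply: eq_bigr => a _; rewrite mxE.
rewrite -[mx_of A]mul1mx -(mulmx1C VWm) -mulmxA VAm mxtrace_mulC -mulmxA VWm.
rewrite mulmx1 mxtrace_diag rmorph_sum /= -(sum_enum_val (fun t => (s t)%:C%C)).
by apply: eq_bigr => a _; rewrite mxE.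
Qed.

(** Adding a multiple of the identity keeps the eigenvectors. The 1 in the weights 1 + j_l of the
    environment state arises in this way. *)
Lemma has_spectrum_shift (T : finType) (A : op R T) s (c : R) :
  has_spectrum A s ->
  has_spectrum (fun t t' => c%:C%C * (t == t')%:R + A t t') (fun t => c + s t).
Proof.
move=> [hA [V [W [VW VA]]]]; split.
  move=> t t'; rewrite rmorphD rmorphM /= -hA conj_real eq_sym; congr (_ * _ + _).
  by case: eqP => _; rewrite ?conjC1 ?conjC0.
exists V, W; split=> // t t'; rewrite rmorphD /= mulrDl -VA.
under eq_bigr do rewrite mulrDr; rewrite big_split /=; congr (_ + _).
rewrite (bigD1 t') //= eqxx mulr1 big1 ?addr0 1?mulrC // => u ut.
by rewrite (negbTE ut) !mulr0.
Qed.

(* [shifted l l' b b'] says b - e_l = b' - e_l'. *)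
Definition shifted n (l l' : 'I_d) (b b' : Occ d n) : bool :=
  [forall i, occ b i + (i == l') == occ b' i + (i == l)]%N.

Lemma shiftedC n l l' (b b' : Occ d n) : shifted l l' b b' = shifted l' l b' b.
Proof. by apply: eq_forallb => i; rewrite eq_sym. Qed.

Lemma shifted_diag n l (b b' : Occ d n) : shifted l l b b' = (b == b').
Proof.
apply/forallP/occP => h i; first by have := h i; rewrite eqn_add2r => /eqP.
by rewrite h.
Qed.

Lemma shifted_neq n l l' (b b' : Occ d n) : l != l' -> shifted l l' b b' ->
  occ b l = (occ b' l).+1 /\ occ b' l' = (occ b l').+1.
Proof.
move=> ll /forallP h; split.
  by have := h l; rewrite eqxx (negbTE ll) addn0 addn1 => /eqP.
by have := h l'; rewrite eqxx (eq_sym l') (negbTE ll) addn0 addn1 => /eqP.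
Qed.

Definition occfact n (b : Occ d n) : nat := \prod_i (occ b i)`!.

(** For distinct [l] and [l'], both sides are the product of factorials of the common vector b +
    e_l' = b' + e_l. *)
Lemma occfact_shifted n l l' (b b' : Occ d n) : shifted l l' b b' ->
  (occfact b * occ b' l' = occfact b' * occ b l)%N.
Proof.
have [<-|ll] := eqVneq l l'; first by rewrite shifted_diag => /eqP ->.
move=> h; have [bl bl'] := shifted_neq ll h.
have up (c : Occ d n) (m : 'I_d) :
    (\prod_i (occ c i + (i == m))`! = occfact c * (occ c m).+1)%N.
  rewrite (bigD1 m) //= eqxx addn1 factS /occfact [in RHS](bigD1 m) //=.
  rewrite (eq_bigr (fun i => (occ c i)`!)) => [|i im].
    by rewrite -mulnA mulnC.
  by rewrite (negbTE im) addn0.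
rewrite bl bl' -!up; apply: eq_bigr => i _.
by move/forallP/(_ i)/eqP: h => ->.
Qed.

(* Second quantisation of [S] on the [n]-particle symmetric space, in the
   orthonormal occupation number basis. *)
Definition gam n (S : op R 'I_d) : op R (Occ d n) := fun b b' =>
  \sum_l \sum_l' S l l' *
    (Num.sqrt ((occ b l)%:R * (occ b' l')%:R) : R)%:C%C * (shifted l l' b b')%:R.

(* Norm of the monomial [b] for the scalar product making the occupation
   number basis orthonormal. *)
Definition occnorm n (b : Occ d n) : R := Num.sqrt (occfact b)%:R.

Lemma occnorm_gt0 n (b : Occ d n) : 0 < occnorm b.
Proof.
rewrite sqrtr_gt0 ltr0n /occfact prodn_gt0 // => i; exact: fact_gt0.
Qed.

(** Under the square root, [occfact_shifted] turns b! b_l b'_l' into b'! b_l^2. Conjugation by the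
    monomial norms thus carries [gam] to the derivation matrix. *)
Lemma gam_dsym n (S : op R 'I_d) (b b' : Occ d n) :
  (occnorm b)%:C%C * gam S b b' =
  (occnorm b')%:C%C * dsym (\matrix_(l, l') S l l') b b'.
Proof.
rewrite /gam /dsym !mulr_sumr; apply: eq_bigr => l _.
rewrite !mulr_sumr; apply: eq_bigr => l' _; rewrite mxE -/(shifted l l' b b').
case h : (shifted l l' b b'); last by rewrite !mulr0.
rewrite !mulr1 mulrCA [RHS]mulrCA; congr (_ * _).
have -> : ((occ b l)%:R : C) = ((occ b l)%:R : R)%:C%C by rewrite rmorph_nat.
rewrite -!(rmorphM (real_complex R)); congr (_%:C%C).
rewrite -[in RHS](ger0_norm (ler0n R (occ b l))) -sqrtr_sqr -!sqrtrM ?ler0n //.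
congr (Num.sqrt _); rewrite mulrA mulrAC -natrM (occfact_shifted h) expr2.
by rewrite natrM mulrA.
Qed.

Lemma gam_spectrum n (S : op R 'I_d) r :
  has_spectrum S r ->
  has_spectrum (@gam n S) (fun b => \sum_l r l * (occ b l)%:R).
Proof.
move=> [hS [V [W [VW VS]]]]; split.
  move=> b b'; rewrite /gam exchange_big rmorph_sum; apply: eq_bigr => l _ /=.
  rewrite rmorph_sum; apply: eq_bigr => l' _ /=.
  rewrite !rmorphM /= -hS conj_real shiftedC [_%:R * _%:R]mulrC.
  by congr (_ * _); case: shifted; rewrite ?conjC1 ?conjC0.
pose Vm : 'M[C]_d := \matrix_(i, j) V i j.
pose Wm : 'M[C]_d := \matrix_(i, j) W i j.
pose Sm : 'M[C]_d := \matrix_(i, j) S i j.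
have VWm : Vm *m Wm = 1%:M.
  by apply/matrixP => i j; rewrite !mxE -VW; apply: eq_bigr => l _; rewrite !mxE.
have VSm : Vm *m Sm = diag_mx (\row_i (r i)%:C%C) *m Vm.
  apply/matrixP => i j; rewrite mul_diag_mx !mxE -VS.
  by apply: eq_bigr => l _; rewrite !mxE.
have gn0 (b : Occ d n) : ((occnorm b)%:C%C : C) != 0.
  by rewrite (fmorph_eq0 (real_complex R)) gt_eqF ?occnorm_gt0.
(* Rows of the symmetric power are eigenvectors of [dsym]; scaling column [b] by [occnorm b] makes
   them eigenvectors of [gam]. *)
exists (fun a b => symm Vm a b * (occnorm b)%:C%C).
exists (fun b c => (occnorm b)%:C%C^-1 * symm Wm b c); split=> a c.
  rewrite -symm1 -VWm symm_mul; apply: eq_bigr => b _.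
  by rewrite mulrA mulfK.
under eq_bigr do rewrite -mulrA gam_dsym mulrCA.
rewrite -mulr_sumr (symm_dsym _ _ VSm) mulrCA; congr (_ * _); last exact: mulrC.
rewrite rmorph_sum; apply: eq_bigr => i _ /=.
by rewrite rmorphM rmorph_nat.
Qed.

End Channels.

(** * The cloner and its complement as second quantisations, with k = n + 1 *)

Section Cloner.
Variables (R : realType) (d n : nat).
Local Notation C := R[i].
Local Notation cst := ('C(n.+1 + d - 1, d)%:R : R).

Definition chanB (S : op R 'I_d) : op R (Occ d n.+1) := fun b b' =>
  \sum_(e : Occ d n) \sum_l \sum_l'
    @Ucl R d n.+1 (b, e) l * S l l' * (@Ucl R d n.+1 (b', e) l')^*.

Definition chanE (S : op R 'I_d) : op R (Occ d n) := fun e e' =>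
  \sum_(b : Occ d n.+1) \sum_l \sum_l'
    @Ucl R d n.+1 (b, e) l * S l l' * (@Ucl R d n.+1 (b, e') l')^*.

Definition hit (b : Occ d n.+1) (e : Occ d n) (l : 'I_d) : bool :=
  [forall i : 'I_d, occ b i == (occ e i + (i == l))%N].

Lemma hitP b e l :
  reflect (forall i, occ b i = (occ e i + (i == l))%N) (hit b e l).
Proof. by apply: (iffP forallP) => h i; have /eqP := h i. Qed.

Lemma Ucl_hit b e l : @Ucl R d n.+1 (b, e) l =
  if hit b e l then (Num.sqrt ((occ e l).+1%:R / cst))%:C%C else 0.
Proof. by []. Qed.

Lemma hit_ex (e : Occ d n) (l : 'I_d) : exists b, hit b e l.
Proof.
have [|b hb] := @occ_surj d n.+1 (fun i => occ e i + (i == l))%N.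
  rewrite big_split /= sum_occ (bigD1 l) //= eqxx big1 ?addn0 ?addn1 // => i.
  by move/negbTE => ->.
by exists b; apply/hitP.
Qed.

Lemma hit_ex2 (b : Occ d n.+1) (l : 'I_d) : (0 < occ b l)%N -> exists e, hit b e l.
Proof.
move=> bl; have le i : ((i == l) <= occ b i)%N by case: eqP => [->|].
have [|e he] := @occ_surj d n (fun i => occ b i - (i == l))%N.
  apply/eqP; rewrite -(eqn_add2r (\sum_i (i == l))%N) -big_split /=.
  rewrite (eq_bigr (occ b)) => [|i _]; last by rewrite subnK.
  rewrite sum_occ (bigD1 l) //= eqxx big1 ?addn0 ?addn1 // => i.
  by move/negbTE => ->.
by exists e; apply/hitP => i; rewrite he subnK.
Qed.

Lemma hit_inj2 b e e' l : hit b e l -> hit b e' l -> e = e'.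
Proof.
move=> /hitP h /hitP h'; apply/eqP/occP => i; apply/eqP.
by rewrite -(eqn_add2r (i == l)) -h -h'.
Qed.

Lemma hit_inj1 b b' e l : hit b e l -> hit b' e l -> b = b'.
Proof. by move=> /hitP h /hitP h'; apply/eqP/occP => i; rewrite h h'. Qed.

Lemma sqrt_cst (x y : nat) :
  Num.sqrt (x%:R / cst) * Num.sqrt (y%:R / cst) =
  cst^-1 * Num.sqrt (x%:R * y%:R).
Proof.
rewrite -sqrtrM ?divr_ge0 // mulrACA [LHS]sqrtrM ?mulr_ge0 //.
have -> : Num.sqrt (cst^-1 * cst^-1) = `|cst^-1| by rewrite -expr2 sqrtr_sqr.
by rewrite ger0_norm ?invr_ge0 // mulrC.
Qed.

(** Only e = b - e_l can contribute, and then 1 + e_l-entry of [e] equals b_l. If b_l = 0 there is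
    no such [e], and the square root vanishes as well. *)
Lemma sum_UclE l l' b b' :
  \sum_(e : Occ d n) @Ucl R d n.+1 (b, e) l * (@Ucl R d n.+1 (b', e) l')^* =
  (cst^-1)%:C%C * ((Num.sqrt ((occ b l)%:R * (occ b' l')%:R))%:C%C *
                   (shifted l l' b b')%:R).
Proof.
have [b0|bl] := posnP (occ b l).
  rewrite b0 mul0r sqrtr0 rmorph0 mul0r mulr0 big1 // => e _.
  rewrite Ucl_hit; case: hitP => [h|_]; last by rewrite mul0r.
  by move: b0; rewrite h eqxx addn1.
have [e he] := hit_ex2 bl.
have -> : shifted l l' b b' = hit b' e l'.
  apply/forallP/hitP => h i.
    have /eqP := h i; rewrite (hitP _ _ _ he) addnAC => /eqP.
    by rewrite eqn_add2r => /eqP.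
  by rewrite h (hitP _ _ _ he) addnAC.
rewrite (bigD1 e) //= big1 ?addr0 => [|e' ee]; last first.
  rewrite Ucl_hit; case: ifP => [h|_]; last by rewrite mul0r.
  by rewrite (hit_inj2 h he) eqxx in ee.
rewrite !Ucl_hit he; case h: (hit b' e l'); last by rewrite conjC0 !mulr0.
rewrite conj_real mulr1 -!(rmorphM (real_complex R)) sqrt_cst.
by rewrite (hitP _ _ _ he) (hitP _ _ _ h) !eqxx !addn1.
Qed.

(** Only b = e + e_l contributes, and it always exists. The indices of [shifted] are swapped because
    a particle is added here instead of removed. *)
Lemma sum_UclB l l' e e' :
  \sum_(b : Occ d n.+1) @Ucl R d n.+1 (b, e) l * (@Ucl R d n.+1 (b, e') l')^* =
  (cst^-1)%:C%C * ((Num.sqrt ((occ e l).+1%:R * (occ e' l').+1%:R))%:C%C *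
                   (shifted l' l e e')%:R).
Proof.
have [b hb] := hit_ex e l.
have -> : shifted l' l e e' = hit b e' l'.
  by apply: eq_forallb => i; rewrite (hitP _ _ _ hb).
rewrite (bigD1 b) //= big1 ?addr0 => [|b' bb]; last first.
  rewrite Ucl_hit; case: ifP => [h|_]; last by rewrite mul0r.
  by rewrite (hit_inj1 h hb) eqxx in bb.
rewrite !Ucl_hit hb; case h: (hit b e' l'); last by rewrite conjC0 !mulr0.
by rewrite conj_real mulr1 -!(rmorphM (real_complex R)) sqrt_cst.
Qed.

Lemma chanB_gam (S : op R 'I_d) b b' :
  chanB S b b' = (cst^-1)%:C%C * gam S b b'.
Proof.
rewrite /chanB /gam exchange_big mulr_sumr; apply: eq_bigr => l _ /=.
rewrite exchange_big mulr_sumr; apply: eq_bigr => l' _ /=.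
under eq_bigr do rewrite mulrAC -mulrC.
by rewrite -mulr_sumr sum_UclE mulrCA -[in RHS]mulrA.
Qed.

(** For l = l' the weight 1 + j_l splits into the trace term and a number operator. For distinct
    [l], [l'] with e + e_l = e' + e_l', the incremented occupations are those of the other vector,
    which gives the entry of [gam] for the transpose of [S]. *)
Lemma chanE_gam (S : op R 'I_d) e e' :
  chanE S e e' = (cst^-1)%:C%C *
    ((\sum_l S l l) * (e == e')%:R + gam (fun l l' => S l' l) e e').
Proof.
rewrite /chanE /gam exchange_big [X in _ + X]exchange_big mulr_suml -big_split.
rewrite mulr_sumr; apply: eq_bigr => l _ /=.
rewrite exchange_big (bigD1 l) //= [in RHS](bigD1 l) //= addrA.
rewrite mulrDr mulr_sumr; congr (_ + _).
  under eq_bigr do rewrite mulrAC -mulrC.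
  rewrite -mulr_sumr sum_UclB mulrCA; congr (_ * _).
  rewrite shifted_diag; case: eqP => [->|_]; last by rewrite !mulr0 addr0.
  rewrite !mulr1 -expr2 sqrtr_sqr ger0_norm // -expr2 sqrtr_sqr ger0_norm //.
  by rewrite -addn1 natrD rmorphD rmorph1 mulrDr mulr1 addrC.
apply: eq_bigr => l' ll.
under eq_bigr do rewrite mulrAC -mulrC.
rewrite -mulr_sumr sum_UclB mulrCA -mulrA; congr (_ * (_ * _)).
case h: (shifted l' l e e'); last by rewrite !mulr0.
have [el el'] := shifted_neq ll h.
by rewrite !mulr1 el el' mulrC.
Qed.

Lemma chanB_spectrum (S : op R 'I_d) r : has_spectrum S r ->
  has_spectrum (chanB S) (fun b => (\sum_l r l * (occ b l)%:R) / cst).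
Proof.
move=> hS; have := has_spectrum_scale cst^-1 (gam_spectrum n.+1 hS).
under [fun b => _ / _]funext do rewrite mulrC.
by apply: has_spectrum_eq => b b'; rewrite chanB_gam.
Qed.

Lemma chanE_spectrum (S : op R 'I_d) r : has_spectrum S r ->
  has_spectrum (chanE S) (fun e => (\sum_l r l * (occ e l).+1%:R) / cst).
Proof.
move=> hS; have := gam_spectrum n (has_spectrum_tr hS).
move=> /(has_spectrum_shift (\sum_l r l)) /(has_spectrum_scale cst^-1) h.
have -> : (fun e : Occ d n => (\sum_l r l * (occ e l).+1%:R) / cst) =
    (fun e => cst^-1 * (\sum_l r l + \sum_l r l * (occ e l)%:R)).
  apply/funext => e; rewrite mulrC -big_split; congr (_ * _).
  by apply: eq_bigr => l _; rewrite -addn1 natrD mulrDr mulr1 addrC.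
apply: has_spectrum_eq h => e e' /=.
by rewrite chanE_gam (trace_spectrum hS).
Qed.

End Cloner.

(** * Counting occupation vectors and their entries *)

Section Counting.

Lemma occ_perm d n (s : 'I_d -> 'I_d) (b : Occ d n) :
  injective s -> exists b' : Occ d n, forall i, occ b' i = occ b (s i).
Proof.
move=> si; apply: occ_surj; rewrite -[RHS](sum_occ b).
by rewrite [RHS](reindex_inj si).
Qed.

Lemma sum_occ_perm (V : nmodType) d n (s : 'I_d -> 'I_d)
    (F G : Occ d n -> V) : injective s ->
  (forall b b', (forall i, occ b' i = occ b (s i)) -> F b' = G b) ->
  \sum_b F b = \sum_b G b.
Proof.
move=> si FG.
have /choice [f hf] : forall b : Occ d n, exists b' : Occ d n,
    forall i, occ b' i = occ b (s i).
  by move=> b; apply: occ_perm.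
have fi : injective f.
  move=> b b' E; apply/eqP/occP => i.
  by rewrite -(f_invF si i) -!hf E.
by rewrite (reindex_inj fi); apply: eq_bigr => b _; apply: FG.
Qed.

(** Stars and bars: occupation vectors are put in bijection with the tuples counted by
    [card_ord_partitions]. *)
Lemma card_Occ m n : #|{: Occ m.+1 n}| = 'C(m + n, m).
Proof.
rewrite -card_ord_partitions card_sig -[LHS]cardsE.
pose f (g : {ffun 'I_m.+1 -> 'I_n.+1}) := [tuple g i | i < m.+1].
have fi : injective f.
  move=> g g' /(congr1 (fun t => tnth t)) E; apply/ffunP => i.
  by have := congr1 (fun h => h i) E; rewrite !tnth_mktuple.
rewrite -(card_imset _ fi); apply: eq_card => t; rewrite [RHS]inE.
apply/imsetP/idP => [[g]|ht].
  rewrite !inE => /eqP hg ->; apply/eqP; rewrite -[RHS]hg big_tuple.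
  by apply: eq_bigr => i _; rewrite tnth_mktuple.
exists [ffun i => tnth t i].
  rewrite !inE; apply/eqP; rewrite -[RHS](eqP ht) big_tuple.
  by apply: eq_bigr => i _; rewrite ffunE.
by apply: eq_from_tnth => i; rewrite tnth_mktuple ffunE.
Qed.

(** By symmetry every coordinate has the same sum, and the d sums total k times the number of
    vectors; then k C(k+d-1,d-1) = d C(k+d-1,d). This is what normalises the output of the
    cloner. *)
Lemma sum_Occ_coord d n (a : 'I_d) :
  (\sum_(b : Occ d n.+1) occ b a)%N = 'C(n.+1 + d - 1, d).
Proof.
case: d a => [[]//|m] a.
have sym l : (\sum_(b : Occ m.+1 n.+1) occ b l)%N =
             (\sum_(b : Occ m.+1 n.+1) occ b a)%N.
  apply: (@sum_occ_perm nat _ _ (tperm a l)); first exact: perm_inj.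
  by move=> b b' ->; rewrite tpermR.
apply/eqP; rewrite -(eqn_pmul2l (ltn0Sn m)).
rewrite -{1}(card_ord m.+1) -sum_nat_const.
under eq_bigr => l _ do rewrite -(sym l).
rewrite exchange_big /=; under eq_bigr do rewrite sum_occ.
rewrite sum_nat_const card_Occ mulnC.
have -> : (n.+1 + m.+1 - 1 = m + n.+1)%N by rewrite addnS subn1 /= addnC.
by rewrite mul_bin_left addKn.
Qed.

End Counting.

(** * The uniform distribution maximises entropy *)

Section Entropy.
Variable R : realType.

Lemma xlog2xM (x y : R) : 0 <= x -> 0 <= y ->
  xlog2x (x * y) = x * xlog2x y + y * xlog2x x.
Proof.
rewrite /xlog2x mulf_eq0 !le_eqVlt ![0 == _]eq_sym.
have [->|x0 /=] := eqVneq x 0; first by rewrite !mul0r !mulr0 addr0.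
have [->|y0 /=] := eqVneq y 0; first by rewrite !mul0r !mulr0 addr0.
move=> xp yp; rewrite lnM ?posrE // mulrDr mulrDl addrC !mulrA.
by congr (_ + _); rewrite [y * x]mulrC.
Qed.

Lemma xlog2x0 : xlog2x (0 : R) = 0.
Proof. by rewrite /xlog2x eqxx. Qed.

(** Gibbs' inequality: [key] is ln z <= z - 1 at z = u / s t, with zero entries treated apart. Its
    linear corrections sum to 1 - #|T| u = 0. *)
Lemma entropy_uniform (T : finType) (s : T -> R) (u : R) :
  (forall t, 0 <= s t) -> \sum_t s t = 1 -> #|T|%:R * u = 1 ->
  - \sum_t xlog2x (s t) <= - \sum_(t : T) xlog2x u.
Proof.
move=> s0 s1 Tu; have u0 : 0 < u.
  have : 0 < #|T|%:R * u by rewrite Tu.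
  rewrite pmulr_rgt0 // ltr0n; case: #|T| Tu => // /eqP.
  by rewrite mul0r eq_sym oner_eq0.
have ln2 : 0 < ln (2 : R) by rewrite ln_gt0 // ltr1n.
have key t : s t * ln u / ln 2 + (s t - u) / ln 2 <= xlog2x (s t).
  rewrite -mulrDl /xlog2x; case: eqVneq => [->|st].
    by rewrite mul0r add0r sub0r mulNr oppr_le0 divr_ge0 // ltW.
  have sp : 0 < s t by rewrite lt_neqAle eq_sym st s0.
  rewrite ler_pM2r ?invr_gt0 // -lerBrDl -mulrBr.
  have /(le_ln1Dx) : -1 < u / s t - 1 by rewrite ltrBDl subrr divr_gt0.
  rewrite addrC subrK lnM ?posrE ?invr_gt0 // lnV ?posrE // => h.
  rewrite -lerN2 -mulrN !opprB -ler_pdivlMl //.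
  by rewrite mulrBr mulVf // mulrC.
rewrite lerN2; apply: le_trans (ler_sum _ (fun t _ => key t)).
rewrite big_split /= -!mulr_suml s1 big_split /= s1 mul1r sumrN.
rewrite !sumr_const -[u *+ _]mulr_natl Tu subrr mul0r addr0.
by rewrite -[xlog2x u *+ _]mulr_natl /xlog2x gt_eqF // !mulrA Tu mul1r.
Qed.

End Entropy.

(** * Entropies of the ensemble state in terms of input spectra *)

Section Formula.
Variables (R : realType) (d n : nat).
Local Notation C := R[i].
Local Notation cst := ('C(n.+1 + d - 1, d)%:R : R).

Lemma vNent_spectrum_eq (T : finType) (A B : op R T) s :
  has_spectrum A s -> (forall t t', A t t' = B t t') ->
  vNent B = - \sum_t xlog2x (s t).
Proof. by move=> hA AB; apply/vNent_spectrum/(has_spectrum_eq AB). Qed.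

(** The map [h] identifies [T] with the product of [S] and [Q]; in these coordinates the filtered
    double sum leaves only the usual sum over the traced factor. *)
Lemma marginal_prod (T S Q : finType) (f : T -> S) (g : T -> Q)
    (h : S -> Q -> T) (rho : op R T) s s' :
  (forall s q, f (h s q) = s) -> (forall s q, g (h s q) = q) ->
  (forall t, h (f t) (g t) = t) ->
  marginal f g rho s s' = \sum_q rho (h s q) (h s' q).
Proof.
move=> fh gh hfg.
have hb : bijective (fun u : S * Q => h u.1 u.2).
  by exists (fun t => (f t, g t)) => [[u v]|t] /=; rewrite ?fh ?gh ?hfg.
pose F s1 q1 s2 q2 := if (s1 == s) && (s2 == s') && (q1 == q2)
  then rho (h s1 q1) (h s2 q2) else 0.
transitivity (\sum_s1 \sum_q1 \sum_s2 \sum_q2 F s1 q1 s2 q2).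
  rewrite pair_bigA /= /marginal (reindex _ (onW_bij _ hb)).
  apply: eq_bigr => u _; rewrite pair_bigA /= (reindex _ (onW_bij _ hb)).
  by apply: eq_bigr => v _; rewrite !fh !gh.
rewrite (bigD1 s) //= [X in _ + X]big1 ?addr0 => [|s1 ns]; last first.
  by do 3 (rewrite big1 // => ? _); rewrite /F (negbTE ns).
apply: eq_bigr => q _.
rewrite (bigD1 s') //= [X in _ + X]big1 ?addr0 => [|s2 ns]; last first.
  by rewrite big1 // => ? _; rewrite /F (negbTE ns) andbF.
rewrite (bigD1 q) //= big1 ?addr0 => [|q2 nq]; last first.
  by rewrite /F eq_sym (negbTE nq) andbF.
by rewrite /F !eqxx.
Qed.

Lemma mulr_shuffle (K : comNzRingType) (u q a b v : K) :
  u * (q * a * b) * v = q * (u * a) * (v * b).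
Proof. ring. Qed.

(** The weights need not sum to 1: for fixed x this is the conditional input multiplied by the
    probability of x. *)
Definition mix (Y : finType) (p : Y -> R) (psi : Y -> 'I_d -> C) : op R 'I_d :=
  fun l l' => \sum_y (p y)%:C%C * psi y l * (psi y l')^*.

Lemma chanB_mix (Y : finType) (p : Y -> R) (psi : Y -> 'I_d -> C) b b' :
  chanB (n := n) (mix p psi) b b' = \sum_y \sum_(e : Occ d n)
    (p y)%:C%C * @Uapp R d n.+1 (psi y) (b, e) *
    (@Uapp R d n.+1 (psi y) (b', e))^*.
Proof.
rewrite exchange_big; apply: eq_bigr => e _ /=.
transitivity (\sum_l' \sum_y \sum_l (p y)%:C%C *
    (Ucl R (b, e) l * psi y l) * (Ucl R (b', e) l' * psi y l')^*).
  rewrite exchange_big; apply: eq_bigr => l' _.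
  rewrite [RHS]exchange_big; apply: eq_bigr => l _.
  rewrite mulr_sumr mulr_suml; apply: eq_bigr => y _; rewrite rmorphM /=.
  exact: mulr_shuffle.
rewrite exchange_big; apply: eq_bigr => y _ /=.
rewrite /Uapp rmorph_sum [RHS]mulr_sumr; apply: eq_bigr => l' _.
by rewrite mulr_sumr mulr_suml.
Qed.

Lemma chanE_mix (Y : finType) (p : Y -> R) (psi : Y -> 'I_d -> C) e e' :
  chanE (n := n) (mix p psi) e e' = \sum_y \sum_(b : Occ d n.+1)
    (p y)%:C%C * @Uapp R d n.+1 (psi y) (b, e) *
    (@Uapp R d n.+1 (psi y) (b, e'))^*.
Proof.
rewrite exchange_big; apply: eq_bigr => b _ /=.
transitivity (\sum_l' \sum_y \sum_l (p y)%:C%C *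
    (Ucl R (b, e) l * psi y l) * (Ucl R (b, e') l' * psi y l')^*).
  rewrite exchange_big; apply: eq_bigr => l' _.
  rewrite [RHS]exchange_big; apply: eq_bigr => l _.
  rewrite mulr_sumr mulr_suml; apply: eq_bigr => y _; rewrite rmorphM /=.
  exact: mulr_shuffle.
rewrite exchange_big; apply: eq_bigr => y _ /=.
rewrite /Uapp rmorph_sum [RHS]mulr_sumr; apply: eq_bigr => l' _.
by rewrite mulr_sumr mulr_suml.
Qed.

(** Entropy of the cloner output, and with [entE] that of the environment, for an input of spectrum
    [r]. Both are also used for unnormalised [r]. *)
Definition entB (r : 'I_d -> R) : R :=
  - \sum_(b : Occ d n.+1) xlog2x ((\sum_l r l * (occ b l)%:R) / cst).

Definition entE (r : 'I_d -> R) : R :=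
  - \sum_(e : Occ d n) xlog2x ((\sum_l r l * (occ e l).+1%:R) / cst).

Lemma cst_gt0 : (0 < d)%N -> 0 < cst.
Proof. by move=> d0; rewrite ltr0n bin_gt0 addSn subn1 leq_addl. Qed.

Lemma sum_B (r : 'I_d -> R) :
  \sum_(b : Occ d n.+1) (\sum_l r l * (occ b l)%:R) / cst = \sum_l r l.
Proof.
rewrite -mulr_suml exchange_big mulr_suml; apply: eq_bigr => l _ /=.
rewrite -mulr_sumr -natr_sum sum_Occ_coord mulfK // gt_eqF // cst_gt0 //.
exact: leq_ltn_trans (ltn_ord l).
Qed.

Lemma sum_delta (a : 'I_d) : \sum_l (l == a)%:R = 1 :> R.
Proof.
by rewrite (bigD1 a) //= eqxx big1 ?addr0 // => l la; rewrite (negbTE la).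
Qed.

Lemma sum_delta_occ (a : 'I_d) (b : Occ d n.+1) :
  \sum_l (l == a)%:R * (occ b l)%:R = (occ b a)%:R :> R.
Proof.
rewrite (bigD1 a) //= eqxx mul1r big1 ?addr0 // => l la.
by rewrite (negbTE la) mul0r.
Qed.

Lemma entB_delta (a a' : 'I_d) :
  entB (fun l => (l == a)%:R) = entB (fun l => (l == a')%:R).
Proof.
congr (- _); apply: (@sum_occ_perm R _ _ (tperm a a')); first exact: perm_inj.
by move=> b b' h; rewrite !sum_delta_occ h tpermL.
Qed.

Variables (nX nY : nat) (p : 'I_nX -> 'I_nY -> R)
  (psi : 'I_nX -> 'I_nY -> 'I_d -> C).
Hypothesis ok : ensemble_ok p psi.
Local Notation w := (@omega R d n.+1 nX nY p psi).

(** The left side is the trace of the cloner output on a pure state; [sum_B] evaluates it from the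
    spectrum. *)
Lemma isometry x y :
  \sum_(be : Occ d n.+1 * Occ d n)
    @Uapp R d n.+1 (psi x y) be * (@Uapp R d n.+1 (psi x y) be)^* = 1.
Proof.
have [_ _ psi1] := ok.
have [a ha] := pure_spectrum (psi1 x y).
have := trace_spectrum (chanB_spectrum n ha).
rewrite sum_B sum_delta rmorph1.
move=> <-; transitivity (\sum_b \sum_e
    @Uapp R d n.+1 (psi x y) (b, e) * (@Uapp R d n.+1 (psi x y) (b, e))^*).
  by rewrite pair_bigA; apply: eq_bigr => -[b e] _.
apply: eq_bigr => b _.
have := @chanB_mix 'I_1 (fun=> 1) (fun=> psi x y) b b.
rewrite big_ord1; under [X in _ = X]eq_bigr do rewrite mul1r.
move=> <-; apply: eq_bigr => e _; apply: eq_bigr => l _; apply: eq_bigr => l' _.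
by rewrite /mix big_ord1 mul1r.
Qed.

Lemma H_YX_eq : H_YX (n.+1) p psi = - \sum_x \sum_y xlog2x (p x y).
Proof.
rewrite exchange_big pair_bigA /=.
apply: (@vNent_spectrum _ _ _ (fun u : 'I_nY * 'I_nX => p u.2 u.1)).
apply: has_spectrum_eq (has_spectrum_diag _) => -[y x] [y' x'].
rewrite (@marginal_prod _ _ _ _ _ (fun u be => (u.2, u.1, be))) //;
  last first.
- by move=> [[]].
- by case.
rewrite /omega /= xpair_eqE; have [_|_] := eqVneq x x'; last first.
  by rewrite andbF big1.
have [_|_] := eqVneq y y'; last by rewrite big1.
under [RHS]eq_bigr do rewrite -mulrA.
by rewrite -mulr_sumr isometry mulr1.
Qed.

Lemma H_X_eq : H_X (n.+1) p psi = - \sum_x xlog2x (\sum_y p x y).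
Proof.
apply: (@vNent_spectrum _ _ _ (fun x : 'I_nX => \sum_y p x y)).
apply: has_spectrum_eq (has_spectrum_diag _) => x x'.
rewrite (@marginal_prod _ _ _ _ _ (fun x q => (x, q.1.1, (q.1.2, q.2)))) //;
  last first.
- by move=> [[? ?] []].
- by move=> ? [[]].
rewrite /omega /=; have [_|_] := eqVneq x x'; last by rewrite big1.
under [RHS]eq_bigr do rewrite eqxx /=.
rewrite -(pair_bigA _ (fun u e => (p x u.1)%:C%C *
   @Uapp R d n.+1 (psi x u.1) (u.2, e) *
   (@Uapp R d n.+1 (psi x u.1) (u.2, e))^*)) /=.
rewrite -(pair_bigA _ (fun y b => \sum_e (p x y)%:C%C *
   @Uapp R d n.+1 (psi x y) (b, e) * (@Uapp R d n.+1 (psi x y) (b, e))^*)) /=.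
rewrite rmorph_sum; apply: eq_bigr => y _ /=.
rewrite pair_bigA /= -[LHS]mulr1 -(isometry x y) mulr_sumr.
by apply: eq_bigr => -[b e] _; rewrite mulrA.
Qed.

Lemma H_B_eq r :
  has_spectrum (mix (fun u : 'I_nX * 'I_nY => p u.1 u.2)
    (fun u => psi u.1 u.2)) r ->
  H_B (n.+1) p psi = entB r.
Proof.
move=> /(chanB_spectrum n) hr; apply: vNent_spectrum.
apply: has_spectrum_eq hr => b b'; rewrite chanB_mix.
rewrite (@marginal_prod _ _ _ _ _ (fun b q => (q.1.1, q.1.2, (b, q.2)))) //;
  last first.
- by move=> [[? ?] []].
- by move=> ? [[]].
rewrite pair_bigA; apply: eq_bigr => -[[x y] e] _.
by rewrite /omega /= !eqxx.
Qed.

(** Given x and y the input is pure, so by [entB_delta] its output entropy is a constant, computed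
    at any basis index [a]. Scaling each block by [p x y] adds the classical entropy of the pair. *)
Lemma H_YXB_eq (a : 'I_d) : H_YXB (n.+1) p psi =
  - (\sum_x \sum_y xlog2x (p x y)) + entB (fun l => (l == a)%:R).
Proof.
have [p0 p1 psi1] := ok.
have /choice [f hf] : forall u : 'I_nY * 'I_nX, exists a, has_spectrum
    (fun l l' => psi u.2 u.1 l * (psi u.2 u.1 l')^*) (fun l => (l == a)%:R).
  by move=> u; apply: pure_spectrum.
have hm (u : 'I_nY * 'I_nX) : has_spectrum
    (mix (fun _ : 'I_1 => p u.2 u.1) (fun=> psi u.2 u.1))
    (fun l => p u.2 u.1 * (l == f u)%:R).
  apply: has_spectrum_eq (has_spectrum_scale (p u.2 u.1) (hf u)) => l l'.
  by rewrite /mix big_ord1 mulrA.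
rewrite /H_YXB (vNent_spectrum_eq
  (has_spectrum_block (fun u => chanB_spectrum n (hm u)))); last first.
  move=> [[y x] b] [[y' x'] b'] /=.
  rewrite (@marginal_prod _ _ _ _ _ (fun u e => (u.1.2, u.1.1, (u.2, e)))) //;
  last first.
  - by move=> [[? ?] []].
  - by move=> [[? ?] ?].
  rewrite /omega /= xpair_eqE; have [_|_] := eqVneq x x'; last first.
    by rewrite andbF big1.
  have [_|_] := eqVneq y y'; last by rewrite big1.
  by rewrite chanB_mix big_ord1.
rewrite -(pair_bigA _ (fun (u : 'I_nY * 'I_nX) (b : Occ d n.+1) => xlog2x
  ((\sum_l p u.2 u.1 * (l == f u)%:R * (occ b l)%:R) / cst))) /=.
rewrite [in RHS]exchange_big [in RHS]pair_bigA /=.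
set E := entB _; rewrite -[in RHS](opprK E) -opprD; congr (- _).
have entp (u : 'I_nY * 'I_nX) : \sum_(b : Occ d n.+1) xlog2x
    ((\sum_l p u.2 u.1 * (l == f u)%:R * (occ b l)%:R) / cst) =
    xlog2x (p u.2 u.1) - p u.2 u.1 * E.
  rewrite /E (entB_delta a (f u)) mulrN opprK -[X in X + _]mulr1.
  rewrite -[X in _ * X + _](sum_delta (f u)) -sum_B !mulr_sumr -big_split /=.
  apply: eq_bigr => b _; under eq_bigr do rewrite -mulrA.
  rewrite -mulr_sumr sum_delta_occ -mulrA xlog2xM ?divr_ge0 //.
  by rewrite addrC; congr (_ + _); exact: mulrC.
under eq_bigr do rewrite entp.
rewrite sumrB -mulr_suml; congr (_ - _).
by rewrite -(pair_bigA _ (fun y x => p x y)) exchange_big p1 mul1r.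
Qed.

Lemma H_XB_eq (r : 'I_nX -> 'I_d -> R) :
  (forall x, has_spectrum (mix (p x) (psi x)) (r x)) ->
  H_XB (n.+1) p psi = \sum_x entB (r x).
Proof.
move=> hr; rewrite /H_XB (vNent_spectrum_eq
  (has_spectrum_block (fun x => chanB_spectrum n (hr x)))); last first.
  move=> [x b] [x' b'] /=.
  rewrite (@marginal_prod _ _ _ _ _ (fun u q => (u.1, q.1, (u.2, q.2)))) //;
  last first.
  - by move=> [[? ?] []].
  - by move=> ? [].
  - by case.
  rewrite /omega /=; have [_|_] := eqVneq x x'; last by rewrite big1.
  rewrite chanB_mix pair_bigA; apply: eq_bigr => -[y e] _ /=.
  by rewrite eqxx.
by rewrite /entB sumrN pair_bigA.
Qed.

Lemma H_XE_eq (r : 'I_nX -> 'I_d -> R) :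
  (forall x, has_spectrum (mix (p x) (psi x)) (r x)) ->
  H_XE (n.+1) p psi = \sum_x entE (r x).
Proof.
move=> hr; rewrite /H_XE (vNent_spectrum_eq
  (has_spectrum_block (fun x => chanE_spectrum n (hr x)))); last first.
  move=> [x e] [x' e'] /=.
  rewrite (@marginal_prod _ _ _ _ _ (fun u q => (u.1, q.1, (q.2, u.2)))) //;
  last first.
  - by move=> [[? ?] []].
  - by move=> ? [].
  - by case.
  rewrite /omega /=; have [_|_] := eqVneq x x'; last by rewrite big1.
  rewrite chanE_mix pair_bigA; apply: eq_bigr => -[y b] _ /=.
  by rewrite eqxx.
by rewrite /entE sumrN pair_bigA.
Qed.

(** H(YX) cancels the classical part of H(YXB), and H(X) cancels in the [lam] term. It survives in
    the [mu] term, as the last summand. *)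
Lemma objective_eq (a : 'I_d) (rt : 'I_d -> R) (r : 'I_nX -> 'I_d -> R)
    (lam mu : R) :
  has_spectrum (mix (fun u : 'I_nX * 'I_nY => p u.1 u.2)
    (fun u => psi u.1 u.2)) rt ->
  (forall x, has_spectrum (mix (p x) (psi x)) (r x)) ->
  objective n.+1 p psi lam mu =
    (1 + mu) * entB rt - entB (fun l => (l == a)%:R) +
    \sum_x (lam * entB (r x) - (lam + mu) * entE (r x)
            - mu * xlog2x (\sum_y p x y)).
Proof.
move=> hrt hr; rewrite /objective /I_YX_B /H_B_given_X /H_E_given_X.
rewrite H_YX_eq H_X_eq (H_B_eq hrt) (H_YXB_eq a) (H_XB_eq hr) (H_XE_eq hr).
rewrite !sumrB -!mulr_sumr.
ring.
Qed.

End Formula.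

(** * Continuity of x log x and maxima on the simplex *)

Section Maximum.
Local Open Scope classical_set_scope.
Variable R : realType.

Lemma ln2_gt0 : 0 < ln (2 : R).
Proof. by rewrite ln_gt0 // ltr1n. Qed.

(** For positive x put y = sqrt x; then -ln y < 1/y bounds |x ln x| = 2 y^2 (-ln y) by 2 y. This
    gives continuity at 0. *)
Lemma norm_xlog2x_le (x : R) : `|x| < 1 ->
  `|xlog2x x| <= 2 / ln 2 * Num.sqrt `|x|.
Proof.
move=> x1; have l2 := ln2_gt0.
have rhs0 : 0 <= 2 / ln 2 * Num.sqrt `|x|.
  by rewrite mulr_ge0 ?divr_ge0 ?sqrtr_ge0 // ltW.
rewrite /xlog2x; case: eqVneq => [_|xn0]; first by rewrite normr0.
have [xp|xle] := ltP 0 x; last by rewrite ln0 // mulr0 mul0r normr0.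
move: x1; rewrite gtr0_norm // => x1.
set y := Num.sqrt x; have yp : 0 < y by rewrite sqrtr_gt0.
have xy : x = y * y by rewrite -expr2 sqr_sqrtr // ltW.
have y1 : y < 1 by rewrite -[X in _ < X]sqrtr1 ltr_sqrt.
have ly : - ln y < y^-1 by rewrite -lnV ?posrE // ln_sublinear // invr_gt0.
rewrite normrM normfV (gtr0_norm l2) mulrAC ler_pM2r ?invr_gt0 //.
rewrite xy lnM ?posrE // normrM gtr0_norm ?mulr_gt0 //.
have lyn : ln y + ln y <= 0
  by rewrite -[X in _ <= X]addr0 lerD // ln_le0 // ltW.
rewrite ler0_norm //.
have -> : y * y * - (ln y + ln y) = 2 * (y * (y * - ln y)) by ring.
by rewrite ler_pM2l // ger_pMr // -ler_pdivlMl // mulr1 ltW.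
Qed.

Lemma xlog2x_continuous : continuous (@xlog2x R).
Proof.
move=> x; have [x0|x0|->] := ltgtP x 0.
(* By convention [ln] is 0 on negative numbers, so the function vanishes near x. *)
- have h : (fun=> 0 : R) @ x --> (0 : R) by apply: cvg_cst.
  have -> : continuous_at x (@xlog2x R) = (@xlog2x R @ x --> (0 : R)).
    by rewrite /continuous_at {2}/xlog2x lt_eqF // ln0 ?mulr0 ?mul0r // ltW.
  apply: cvg_trans h; apply: near_eq_cvg; near=> y.
  have y0 : y < 0 by near: y; exact: lt_nbhsl.
  by rewrite /xlog2x lt_eqF // ln0 ?mulr0 ?mul0r // ltW.
- have h : (fun y : R => y * ln y / ln 2) @ x --> x * ln x / ln 2.
    by apply: cvgMr_tmp; apply: cvgM; [exact: cvg_id|exact: continuous_ln].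
  have -> : continuous_at x (@xlog2x R) = (@xlog2x R @ x --> x * ln x / ln 2).
    by rewrite /continuous_at {2}/xlog2x gt_eqF.
  apply: cvg_trans h; apply: near_eq_cvg; near=> y.
  have y0 : 0 < y by near: y; exact: lt_nbhsr.
  by rewrite /xlog2x gt_eqF.
- rewrite /continuous_at [X in _ --> X](_ : _ = 0) ?xlog2x0 //.
  apply/cvgrPdist_lt => e e0.
  pose K : R := 2 / ln 2.
  have K0 : 0 < K by rewrite divr_gt0 // ln2_gt0.
  (* The first bound allows [norm_xlog2x_le]; the second makes K sqrt |y| < e. *)
  pose c := Num.min 1 ((e / K) ^+ 2).
  have c0 : 0 < c by rewrite lt_min ltr01 exprn_gt0 // divr_gt0.
  near=> y; rewrite sub0r normrN.
  have yc : `|y| < c by near: y; exists c => //= z; rewrite /= sub0r normrN.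
  move: yc; rewrite lt_min => /andP [y1 ye].
  apply: le_lt_trans (norm_xlog2x_le y1) _; rewrite -/K mulrC -ltr_pdivlMr //.
  have -> : e / K = Num.sqrt ((e / K) ^+ 2).
    by rewrite sqrtr_sqr ger0_norm // ltW // divr_gt0.
  by rewrite ltr_sqrt // exprn_gt0 // divr_gt0.
Unshelve. all: by end_near.
Qed.

Lemma sum_continuous (T : topologicalType) (I : Type) (s : seq I)
    (F : I -> T -> R) :
  (forall i, continuous (F i)) -> continuous (fun v => \sum_(i <- s) F i v).
Proof.
move=> cF; elim: s => [|i s IH] v.
  rewrite (_ : (fun _ => _) = fun=> 0); first exact: cvg_cst.
  by apply/funext => u; rewrite big_nil.
rewrite (_ : (fun _ => _) = fun u => F i u + \sum_(j <- s) F j u).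
  by apply: cvgD; [exact: cF|exact: IH].
by apply/funext => u; rewrite big_cons.
Qed.

(** The simplex is a closed subset of the compact unit cube and contains a vertex, so the extreme
    value theorem applies. *)
Lemma simplex_max m (f : ('I_m.+1 -> R) -> R) :
  continuous (fun v : 'rV[R]_m.+1 => f (fun i => v 0 i)) ->
  exists q : 'I_m.+1 -> R,
    [/\ forall i, 0 <= q i, \sum_i q i = 1 &
        forall r, (forall i, 0 <= r i) -> \sum_i r i = 1 -> f r <= f q].
Proof.
move=> cf; pose A : set 'rV[R]_m.+1 :=
  ([set v : 'rV[R]_m.+1 | forall i, (`[0, 1]%classic : set R) (v ord0 i)] `&`
   ((fun v : 'rV[R]_m.+1 => \sum_i v 0 i) @^-1` [set 1]))%classic.
have cA : compact A.
  apply: compact_closedI.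
    apply: (@rV_compact R m.+1 (fun=> `[0, 1]%classic)) => i.
    exact: segment_compact.
  apply: closed_comp; last exact: closed_eq.
  move=> v _; apply: sum_continuous => i; exact: coord_continuous.
have [|v vA vmax] := compact_EVT_max _ cA (continuous_subspaceT cf).
  exists (delta_mx 0 0); split=> [i|] /=.
    by rewrite mxE in_itv /=; case: eqP => _; rewrite ?lexx ?ler01.
  rewrite (bigD1 ord0) //= mxE !eqxx big1 ?addr0 // => i i0.
  by rewrite mxE (negbTE i0) andbF.
have [v01 v1] : A v by apply: set_mem.
exists (fun i => v 0 i); split=> //.
  by move=> i; have := v01 i; rewrite /= in_itv /= => /andP [].
move=> r r0 r1; have : (\row_i r i) \in A.
  apply: mem_set; split=> [i|] /=.
    rewrite mxE in_itv /= r0 -r1 (bigD1 i) //= lerDl.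
    exact: sumr_ge0.
  by rewrite -r1; apply: eq_bigr => i _; rewrite mxE.
move/vmax; rewrite (_ : (fun i => (\row_i r i) 0 i) = r) //.
by apply/funext => i; rewrite mxE.
Qed.

End Maximum.

(** * Homogeneity and symmetry of the conditional gain *)

Section Optimum.
Variables (R : realType) (d n : nat).
Local Notation C := R[i].
Local Notation cst := ('C(n.+1 + d - 1, d)%:R : R).
Implicit Types q r : 'I_d -> R.

(** The number of vectors plus the sum of coordinate [a] is a case of Pascal's rule. The case n = 0
    is separate since [sum_Occ_coord] concerns a positive particle number. *)
Lemma sum_Occ_coordS (a : 'I_d) :
  (\sum_(e : Occ d n) (occ e a).+1)%N = 'C(n.+1 + d - 1, d).
Proof.
under eq_bigr do rewrite -add1n.
rewrite big_split /= sum1_card.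
case: (n) => [|m].
  rewrite big1 => [|e _]; last first.
    apply/eqP; rewrite -leqn0 -[X in (_ <= X)%N](sum_occ e).
    by rewrite (bigD1 a) // leq_addr.
  by case: d a => [[]//|m] a; rewrite card_Occ !addn0 addKn !binn.
rewrite sum_Occ_coord; case: d a => [[]//|m'] a; rewrite card_Occ.
have -> : (m.+2 + m'.+1 - 1 = (m' + m.+1).+1)%N.
  by rewrite addnS subn1 /= addSn addnC.
have -> : (m.+1 + m'.+1 - 1 = m' + m.+1)%N by rewrite addnS subn1 /= addnC.
by rewrite binS addnC.
Qed.

Lemma sum_E r :
  \sum_(e : Occ d n) (\sum_l r l * (occ e l).+1%:R) / cst = \sum_l r l.
Proof.
rewrite -mulr_suml exchange_big mulr_suml; apply: eq_bigr => l _ /=.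
rewrite -mulr_sumr -natr_sum sum_Occ_coordS mulfK // gt_eqF // cst_gt0 //.
exact: leq_ltn_trans (ltn_ord l).
Qed.

Lemma sum_xlog2x_scale (T : finType) (c : R) (s : T -> R) :
  0 <= c -> (forall t, 0 <= s t) ->
  \sum_t xlog2x (c * s t) = c * \sum_t xlog2x (s t) + xlog2x c * \sum_t s t.
Proof.
move=> c0 s0; rewrite !mulr_sumr -big_split; apply: eq_bigr => t _ /=.
by rewrite xlog2xM // [s t * _]mulrC.
Qed.

Lemma entB_scale (c : R) q : 0 <= c -> (forall l, 0 <= q l) ->
  entB n (fun l => c * q l) = c * entB n q - xlog2x c * \sum_l q l.
Proof.
move=> c0 q0; rewrite mulrN -opprD -(sum_B n q) -sum_xlog2x_scale //.
  congr (- _); apply: eq_bigr => b _; congr xlog2x.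
  rewrite mulrA mulr_sumr; congr (_ / _).
  by apply: eq_bigr => l _; rewrite mulrA.
by move=> b; rewrite divr_ge0 // sumr_ge0 // => l _; rewrite mulr_ge0.
Qed.

Lemma entE_scale (c : R) q : 0 <= c -> (forall l, 0 <= q l) ->
  entE n (fun l => c * q l) = c * entE n q - xlog2x c * \sum_l q l.
Proof.
move=> c0 q0; rewrite mulrN -opprD -(sum_E q) -sum_xlog2x_scale //.
  congr (- _); apply: eq_bigr => b _; congr xlog2x.
  rewrite mulrA mulr_sumr; congr (_ / _).
  by apply: eq_bigr => l _; rewrite mulrA.
by move=> b; rewrite divr_ge0 // sumr_ge0 // => l _; rewrite mulr_ge0.
Qed.

(** The function F of the overview, extended to unnormalised spectra. *)
Definition gain lam mu q : R := lam * entB n q - (lam + mu) * entE n q.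

(** Scaling shifts [entB] and [entE] by the same -xlog2x c; weighted by lam and -(lam + mu) the
    shifts leave mu xlog2x c, which the subtracted term removes. *)
Lemma gain_scale lam mu (c : R) q : 0 <= c -> (forall l, 0 <= q l) ->
  \sum_l q l = 1 ->
  gain lam mu (fun l => c * q l) - mu * xlog2x c = c * gain lam mu q.
Proof.
move=> c0 q0 q1; rewrite /gain entB_scale // entE_scale // q1; ring.
Qed.

Lemma gain_perm lam mu q (s : 'I_d -> 'I_d) : injective s ->
  gain lam mu (fun l => q (s l)) = gain lam mu q.
Proof.
move=> si; rewrite /gain; congr (_ * _ - _ * _); congr (- _).
  apply: (@sum_occ_perm R _ _ s) => // b b' h; congr xlog2x; congr (_ / _).
  by rewrite [RHS](reindex_inj si); apply: eq_bigr => l _; rewrite h.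
apply: (@sum_occ_perm R _ _ s) => // b b' h; congr xlog2x; congr (_ / _).
by rewrite [RHS](reindex_inj si); apply: eq_bigr => l _; rewrite h.
Qed.

Lemma gain_bound lam mu (M : R) r :
  (0 < d)%N ->
  (forall q, (forall l, 0 <= q l) -> \sum_l q l = 1 -> gain lam mu q <= M) ->
  (forall l, 0 <= r l) ->
  gain lam mu r - mu * xlog2x (\sum_l r l) <= (\sum_l r l) * M.
Proof.
move=> d0 hM r0; set c := \sum_l r l; have c0 : 0 <= c by apply: sumr_ge0.
(* If x has probability 0 then [r] is zero and any distribution serves as [q]; otherwise normalise
   [r]. *)
have [q [q0 q1 rq]] : exists q, [/\ forall l, 0 <= q l, \sum_l q l = 1 &
    r = (fun l => c * q l)].
  have [cz|cn] := eqVneq c 0.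
    exists (fun l => (l == Ordinal d0)%:R); split=> //; first exact: sum_delta.
    apply/funext => l; rewrite cz mul0r; apply/eqP.
    rewrite eq_le r0 andbT -cz /c (bigD1 l) //= lerDl; exact: sumr_ge0.
  exists (fun l => r l / c); split=> [l||]; first by rewrite divr_ge0.
    by rewrite -mulr_suml mulfV.
  by apply/funext => l; rewrite mulrCA mulfV // mulr1.
by rewrite {1}rq gain_scale // ler_wpM2l // hM.
Qed.

End Optimum.

(** * Continuity of the gain in the spectrum *)

Section Continuity.
Local Open Scope classical_set_scope.

Lemma gain_continuous (R : realType) (m n : nat) (lam mu : R) :
  continuous (fun v : 'rV[R]_m.+1 => gain n lam mu (fun i => v 0 i)).
Proof.
have lin_cont (a : 'I_m.+1 -> R) (c : R) :
    continuous (fun v : 'rV[R]_m.+1 => (\sum_l v 0 l * a l) / c).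
  have cs : continuous (fun v : 'rV[R]_m.+1 => \sum_l v 0 l * a l).
    apply: (@sum_continuous R _ _ _ (fun l (u : 'rV[R]_m.+1) => u 0 l * a l)).
    move=> l u; have cc : (fun u : 'rV[R]_m.+1 => u 0 l) @ u --> u 0 l.
      exact: coord_continuous.
    exact: (@cvgMr_tmp _ _ _ _ _ _ (a l) cc).
  by move=> v; exact: (@cvgMr_tmp _ _ _ _ _ _ c^-1 (cs v)).
have xl_cont (I : finType) (a : I -> 'I_m.+1 -> R) (c : R) :
    continuous (fun v : 'rV[R]_m.+1 =>
      - \sum_i xlog2x ((\sum_l v 0 l * a i l) / c)).
  have cs : continuous (fun v : 'rV[R]_m.+1 =>
      \sum_i xlog2x ((\sum_l v 0 l * a i l) / c)).
    apply: (@sum_continuous R _ _ _ (fun i (u : 'rV[R]_m.+1) =>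
      xlog2x ((\sum_l u 0 l * a i l) / c))) => i u.
    exact: (@continuous_comp _ _ _
      (fun u : 'rV[R]_m.+1 => (\sum_l u 0 l * a i l) / c) (@xlog2x R) u
      (lin_cont _ _ u) (@xlog2x_continuous R _)).
  by move=> v; exact: (cvgN (cs v)).
move=> v; have cB := xl_cont (Occ m.+1 n.+1) (fun b l => (occ b l)%:R).
have cE := xl_cont (Occ m.+1 n) (fun e l => (occ e l).+1%:R).
exact: (cvgB (@cvgMl_tmp _ _ _ _ _ lam _ (cB _ v))
             (@cvgMl_tmp _ _ _ _ _ (lam + mu) _ (cE _ v))).
Qed.

End Continuity.

(** For the uniform spectrum every eigenvalue of the output is k/d divided by the binomial, since
    the occupations sum to k. The output is then flat and [entropy_uniform] applies. *)
Lemma entB_le_uniform (R : realType) (m n : nat) (r : 'I_m.+1 -> R) :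
  (forall l, 0 <= r l) -> \sum_l r l = 1 ->
  entB n r <= entB n (fun _ : 'I_m.+1 => m.+1%:R^-1).
Proof.
move=> r0 r1.
have unif (b : Occ m.+1 n.+1) :
    (\sum_(l < m.+1) m.+1%:R^-1 * (occ b l)%:R) /
    'C(n.+1 + m.+1 - 1, m.+1)%:R =
    m.+1%:R^-1 * n.+1%:R / 'C(n.+1 + m.+1 - 1, m.+1)%:R :> R.
  by rewrite -mulr_sumr -natr_sum sum_occ.
rewrite [X in _ <= X]/entB; under [X in _ <= - X]eq_bigr do rewrite unif.
apply: entropy_uniform.
- by move=> b; rewrite divr_ge0 // sumr_ge0 // => l _; rewrite mulr_ge0.
- by rewrite sum_B.
- have := sum_B n (fun _ : 'I_m.+1 => (m.+1%:R^-1 : R)).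
  under eq_bigr do rewrite unif.
  rewrite sumr_const mulr_natl => ->.
  by rewrite sumr_const card_ord -[LHS]mulr_natl mulfV ?pnatr_eq0.
Qed.

(** * The ensemble of cyclic shifts and its value *)

Section CyclicEnsemble.
Variables (R : realType) (m n : nat) (q : 'I_m.+1 -> R).
Local Notation C := R[i].
Hypotheses (q0 : forall l, 0 <= q l) (q1 : \sum_l q l = 1).
Local Notation nu := (fun j => q (inord j)).
Local Notation p := (@p_opt R m.+1 nu).

Lemma qnuE j : (j < m.+1)%N -> qnu m.+1 nu j = q (inord j).
Proof.
move=> jm; rewrite /qnu; case: eqP => [->|//].
rewrite -q1 -(eq_bigr _ (fun i _ => congr1 q (inord_val i))).
rewrite -(big_mkord xpredT (fun i => q (inord i))) big_ltn //.
by rewrite addrK.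
Qed.

(* The group structure of ['I_m.+1] is that of the integers modulo m + 1. *)
Lemma p_optE x y : p x y = m.+1%:R^-1 * q (y - x).
Proof.
rewrite /p_opt qnuE ?ltn_pmod // mulrC; congr (_ * q _).
apply/val_inj; rewrite /= inordK ?ltn_pmod // modnDmr addnBA //.
exact: ltnW.
Qed.

Lemma sum_p_opt x : \sum_y p x y = m.+1%:R^-1.
Proof.
under eq_bigr do rewrite p_optE.
rewrite -mulr_sumr -[RHS]mulr1 -q1; congr (_ * _).
by rewrite [RHS](reindex_inj (addIr (- x))).
Qed.

(** Since x -> y - x is a bijection modulo d, the average input is maximally mixed. *)
Lemma sum_p_opt_x y : \sum_x p x y = m.+1%:R^-1.
Proof.
under eq_bigr do rewrite p_optE.
rewrite -mulr_sumr -[RHS]mulr1 -q1; congr (_ * _).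
by rewrite [RHS](reindex_inj (subrI y)).
Qed.

Lemma opt_ok : ensemble_ok p (@psi_opt R m.+1).
Proof.
split=> [x y||x y].
- by rewrite p_optE mulr_ge0 ?invr_ge0.
- under eq_bigr do rewrite sum_p_opt.
  by rewrite sumr_const card_ord -[LHS]mulr_natl mulfV ?pnatr_eq0.
- rewrite (bigD1 y) //= /psi_opt eqxx conjC1 mulr1 big1 ?addr0 // => l ly.
  by rewrite (negbTE ly) mul0r.
Qed.

Lemma mix_basis (Y : finType) (P : Y -> R) (f : Y -> 'I_m.+1) (l l' : 'I_m.+1) :
  mix P (fun y => @psi_opt R m.+1 0 (f y)) l l' =
  if l == l' then (\sum_(y | f y == l) P y)%:C%C else 0.
Proof.
rewrite /mix /psi_opt; case: eqVneq => [<-|ll]; last first.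
  apply: big1 => y _; case: eqVneq => [<-|_]; last by rewrite mulr0 mul0r.
  by rewrite eq_sym (negbTE ll) conjC0 mulr0.
rewrite rmorph_sum [RHS]big_mkcond; apply: eq_bigr => y _ /=; rewrite eq_sym.
by case: eqP => _; rewrite ?conjC1 ?mulr1 // mulr0 mul0r.
Qed.

Lemma objective_opt lam mu : objective n.+1 p (@psi_opt R m.+1) lam mu =
  (1 + mu) * entB n (fun _ : 'I_m.+1 => m.+1%:R^-1)
    - entB n (fun l : 'I_m.+1 => (l == 0)%:R) + gain n lam mu q.
Proof.
have hr x : has_spectrum (mix (p x) (@psi_opt R m.+1 x)) (p x).
  apply: has_spectrum_eq (has_spectrum_diag _) => l l'.
  rewrite (mix_basis (p x) id); case: eqP => // _.
  by rewrite big_pred1_eq.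
have hrt : has_spectrum (mix (fun u : 'I_m.+1 * 'I_m.+1 => p u.1 u.2)
    (fun u => @psi_opt R m.+1 u.1 u.2)) (fun=> m.+1%:R^-1).
  apply: has_spectrum_eq (has_spectrum_diag _) => l l'.
  rewrite (mix_basis (fun u : 'I_m.+1 * 'I_m.+1 => p u.1 u.2) snd).
  case: eqP => // _; congr (_%:C%C); rewrite -(sum_p_opt_x l).
  rewrite -(pair_big xpredT (fun y => y == l) (fun x y => p x y)) /=.
  by apply: eq_bigr => x _; rewrite big_pred1_eq.
rewrite (objective_eq n opt_ok 0 lam mu hrt hr); congr (_ + _).
(* Each conditional spectrum is 1/d times a cyclic shift of [q], so all d terms agree by scaling and
   permutation invariance. *)
have term x : lam * entB n (p x) - (lam + mu) * entE n (p x)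
    - mu * xlog2x (\sum_y p x y) = m.+1%:R^-1 * gain n lam mu q.
  rewrite sum_p_opt -/(gain n lam mu (p x)).
  have -> : p x = (fun l => m.+1%:R^-1 * q (l - x)).
    by apply/funext => l; rewrite p_optE.
  rewrite gain_scale ?invr_ge0 //; last first.
    by rewrite -[RHS]q1 [RHS](reindex_inj (addIr (- x))).
  by rewrite (gain_perm n lam mu q (addIr (- x))).
under eq_bigr do rewrite term.
by rewrite sumr_const card_ord -[LHS]mulr_natl mulrA mulfV ?pnatr_eq0 ?mul1r.
Qed.

End CyclicEnsemble.

Theorem theorem6 (R : realType) (d k : nat) (lam mu : R) :
  (2 <= d)%N -> (1 <= k)%N -> 0 <= lam -> 0 <= mu ->
  exists nu : nat -> R,
    [/\ forall m, (1 <= m < d)%N -> 0 <= nu m,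
        \sum_(1 <= m < d) nu m <= 1 &
        forall (nX nY : nat) (p : 'I_nX -> 'I_nY -> R)
               (psi : 'I_nX -> 'I_nY -> 'I_d -> R[i]),
          ensemble_ok p psi ->
          @objective R d k nX nY p psi lam mu
            <= @objective R d k d d (@p_opt R d nu) (@psi_opt R d) lam mu].
Proof.
case: d => [//|m]; case: k => [//|n] _ _ lam0 mu0.
have [q [q0 q1 qmax]] := simplex_max (@gain_continuous R m n lam mu).
exists (fun j => q (inord j)); split=> [j _||nX nY p psi ok]; first exact: q0.
  (* The defect 1 - sum of the nu is the remaining coordinate [q] at 0, which is nonnegative. *)
  rewrite -subr_ge0; have := @qnuE R m q q1 0 isT.
  by rewrite /qnu eqxx => ->.
rewrite objective_opt //; have [p0 p1 psi1] := ok.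
have /choice [r hr] : forall x, exists r : 'I_m.+1 -> R,
    [/\ forall l, 0 <= r l, \sum_l r l = \sum_y p x y &
        has_spectrum (mix (p x) (psi x)) r].
  by move=> x; apply: mixture_spectrum.
have [||rt [rt0 rt1 hrt]] := @mixture_spectrum R m.+1 ('I_nX * 'I_nY)%type
    (fun u => p u.1 u.2) (fun u => psi u.1 u.2); [by []|by []|].
have hrs x : has_spectrum (mix (p x) (psi x)) (r x) by have [] := hr x.
rewrite (objective_eq n ok 0 lam mu hrt hrs).
have {}rt1 : \sum_l rt l = 1 by rewrite rt1 -p1 pair_bigA.
(* The entropy of B and the conditional gains are bounded separately; the first bound uses that 1 +
   mu is nonnegative. *)
apply: lerD; first by rewrite lerB // ler_wpM2l ?addr_ge0 // entB_le_uniform.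
(* The maximal gain is spread over x with the weights of X, so that [gain_bound] applies
   termwise. *)
rewrite -[leRHS]mul1r -p1 mulr_suml; apply: ler_sum => x _.
have [rx0 <- _] := hr x.
exact: gain_bound.
Qed.
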